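(* A fully actuated controlled mechanical system ($m=r$) does not have totally singular extremals. More precisely, let $k\in I=\{1,\dots,r\}$ be fixed and let $(x,\lambda,u)$ be an extremal on $[0,T]$ that is $u_i$-singular for all $i\in I$, $i\neq k$. Then the extremal is $u_k$-regular. Moreover, if one of the following two conditions is satisfied, then the component $u_k$ of the control is constant (almost everywhere): (i) $\mathrm{Span}\{g_i,[f,g_j],\mathrm{ad}_f^2g_j:\ i,j\in I,\ j\ne k\}=\mathbb{R}^{2r}$ along the extremal; (ii) the extremal is abnormal, and along the extremal $\mathrm{Span}\{f,g_i,[f,g_j]:\ i,j\in I,\ j\neq k\}=\mathbb{R}^{2r}$. Computation of the singular controls: along a time interval on which $\phi_k$ does not vanish, the $r-1$ singular components of the control satisfy (a.e.) the system $$\frac{\lambda^t\,\mathrm{ad}_f^2g_i(x)+\alpha_{ik}^k(x)\,\phi_k\,u_k}{\phi_k}=-\sum_{j\ne k}\alpha_{ij}^k(x)\,u_j,\qquad i\in I\setminus\{k\},$$ and they are determined by it under the hypothesis $\det(\alpha_{ij}^k(x))_{i,j\in I\setminus\{k\}}\neq0$.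
   Context: Controlled mechanical system: on $\mathbb{R}^r$, $Q(q)u=M(q)\ddot q+N(q,\dot q)$, where $M(q)$ is a symmetric positive definite $r\times r$ matrix, $N(q,\dot q)\in\mathbb{R}^r$, $Q(q)$ is an $r\times m$ matrix of rank $m$ ($m\le r$), all smooth; fully actuated means $m=r$. Let $\psi:\mathbb{R}^r\to\mathbb{R}^r$ be a smooth diffeomorphism and $P(q)$ a smooth invertible $r\times r$ matrix; with $x_1=\psi(q)$, $x_2=P(q)\dot q$, $x=(x_1,x_2)\in\mathbb{R}^{2r}$, the system becomes $\dot x=f(x)+\sum_{i=1}^mg_i(x)u_i$ with $f(x)=(F(x_1)x_2,\hat f(x_1,x_2))$, $F=\frac{d\psi}{dq}P^{-1}$, $\hat f=\dot PP^{-1}x_2-PM^{-1}N(\psi^{-1}(x_1),P^{-1}x_2)$, and $g_i(x)=(0,\hat g_i(x_1))$, where $\hat g_i$ are the columns of $\hat G=PM^{-1}Q$ (matrices evaluated at $q=\psi^{-1}(x_1)$; $\dot P$ is the derivative of $P$ in the direction $\dot q=P^{-1}x_2$). Controls: measurable $u:[0,T]\to\mathbb{R}^m$ with $u(t)\in\mathcal{U}=\{u:\alpha_i\le u_i\le\beta_i\}$ a.e., where $\alpha_i<0<\beta_i$ are fixed constants. Lie bracket: $[X,Y](x)=DY(x)X(x)-DX(x)Y(x)$; $\mathrm{ad}_f^0g=g$, $\mathrm{ad}_f^{s+1}g=[f,\mathrm{ad}_f^sg]$. Spans are real spans of values at points $x(t)$; ''along the extremal'' means at $x(t)$ for every $t\in[0,T]$.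 Hamiltonian: $H(\lambda,x,u)=\lambda^tf(x)+\sum_i\lambda^tg_i(x)u_i$. An extremal on $[0,T]$ is a triple $(x,\lambda,u)$, $u$ admissible, $x,\lambda:[0,T]\to\mathbb{R}^{2r}$ absolutely continuous, $\lambda(t)\ne0$ for all $t$, such that for a.e. $t$: $\dot x=\partial H/\partial\lambda$, $\dot\lambda=-\partial H/\partial x$, $H(\lambda(t),x(t),u(t))=\max_{v\in\mathcal{U}}H(\lambda(t),x(t),v)$, and $H(\lambda(t),x(t),u(t))=\lambda_0$ for a constant $\lambda_0\ge0$; it is abnormal if $\lambda_0=0$. Switching functions: $\phi_i(t)=\lambda^t(t)g_i(x(t))$. The extremal is $u_i$-singular on a nontrivial interval if $\phi_i\equiv0$ there ($u_i$-singular without mention of an interval: on $[0,T]$); it is totally singular on a nontrivial interval if it is $u_i$-singular there for every $i$. The component $u_i$ is bang-bang if it takes values in $\{\alpha_i,\beta_i\}$ for a.e. $t$; a switching time is a $t_s\in[0,T]$ such that $u_i$ is not a.e. constant on any $(t_s-\varepsilon,t_s+\varepsilon)\cap[0,T]$, $\varepsilon>0$; the extremal is $u_i$-regular if $u_i$ is bang-bang with at most finitely many switching times. For a fully actuated system the smooth functions $\alpha_{ij}^k$ are defined by $[g_j,[f,g_i]](x)=\sum_{k=1}^r\alpha_{ij}^k(x)g_k(x)$. *)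

(* Defs.v *)
From HB Require Import structures.
From mathcomp Require Import all_boot all_order all_algebra.
From mathcomp Require Import all_classical all_reals all_analysis.
From mathcomp Require Import measurable_realfun.

Set Implicit Arguments.
Unset Strict Implicit.
Unset Printing Implicit Defensive.

Import Order.TTheory GRing.Theory Num.Theory.
Import numFieldNormedType.Exports.

Local Open Scope classical_set_scope.
Local Open Scope ring_scope.

Section Calculus.
Context {R : realType}.

(* Used for finite-dimensional V and W only, where this is the usual C^n: the
   derivatives in all directions are of class C^(n-1). *)
Fixpoint of_class_C {V W : normedModType R} (n : nat) (F : V -> W) : Prop :=
  if n is n'.+1 then
    (forall x, differentiable F x) /\ (forall v, of_class_C n' ('D_v F))
  else continuous F.

Definition smooth {V W : normedModType R} (F : V -> W) : Prop :=
  forall n, of_class_C n F.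

(* The library's jacobian acts on row vectors; vectors are columns here. *)
Definition jac {n p : nat} (F : 'cV[R]_n -> 'cV[R]_p) (x : 'cV[R]_n) :
    'M[R]_(p, n) :=
  \matrix_(i, j) ('D_(delta_mx j 0) F x) i 0.

Definition grad {n : nat} (h : 'cV[R]_n -> R) (x : 'cV[R]_n) : 'cV[R]_n :=
  \col_i 'D_(delta_mx i 0) h x.

Definition lie {n : nat} (X Y : 'cV[R]_n -> 'cV[R]_n) (x : 'cV[R]_n) :
    'cV[R]_n :=
  'd Y x (X x) - 'd X x (Y x).

Definition ad {n : nat} (X : 'cV[R]_n -> 'cV[R]_n) (s : nat)
    (Y : 'cV[R]_n -> 'cV[R]_n) : 'cV[R]_n -> 'cV[R]_n :=
  iter s (lie X) Y.

Definition dotv {n : nat} (l v : 'cV[R]_n) : R := (l^T *m v) 0 0.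

Definition abs_continuous_on {V : normedModType R} (a b : R) (F : R -> V) :
    Prop :=
  forall e : R, 0 < e -> exists2 d : R, 0 < d &
    forall (n : nat) (c : 'I_n -> R * R),
      (forall i, a <= (c i).1 /\ (c i).1 <= (c i).2 /\ (c i).2 <= b) ->
      trivIset setT (fun i => `](c i).1, (c i).2[%classic) ->
      \sum_i ((c i).2 - (c i).1) < d ->
      \sum_i `|F (c i).2 - F (c i).1| < e.

(* Measurable for the completed (Lebesgue) sigma-algebra at the source and the
   Borel one at the target; the library's measurable_fun on R is Borel at both
   ends. *)
Definition lebesgue_measurable_fun (D : set R) (v : R -> R) : Prop :=
  @measurable_fun _ _
    (g_sigma_algebraType (completed_algebra_gen (@lebesgue_measure R)))
    (measurableTypeR R) D v.

Definition ae_on (D : set R) (A : R -> Prop) : Prop :=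
  {ae @lebesgue_measure R, forall t, D t -> A t}.

Definition ae_constant_on (D : set R) (v : R -> R) : Prop :=
  exists c : R, ae_on D (fun t => v t = c).

Definition switching_time (T : R) (v : R -> R) (ts : R) : Prop :=
  `[0, T]%classic ts /\
  forall e : R, 0 < e ->
    ~ ae_constant_on (`]ts - e, ts + e[ `&` `[0, T]) v.

Definition bang_bang (T a b : R) (v : R -> R) : Prop :=
  ae_on `[0, T] (fun t => v t = a \/ v t = b).

Definition nontrivial_subinterval (T : R) (J : interval R) : Prop :=
  [set` J] `<=` `[0, T] /\ exists s t : R, [/\ s \in J, t \in J & s < t].

End Calculus.

(* Q(q) u = M(q) q'' + N(q, q'), with configuration space R^r, m controls *)
Record mech_system (R : realType) (r m : nat) := MechSystem {
  Mmat : 'cV[R]_r -> 'M[R]_r ;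
  Nvec : 'cV[R]_r * 'cV[R]_r -> 'cV[R]_r ;
  Qmat : 'cV[R]_r -> 'M[R]_(r, m) ;
  Mmat_smooth : smooth Mmat ;
  Nvec_smooth : smooth Nvec ;
  Qmat_smooth : smooth Qmat ;
  Mmat_sym : forall q, (Mmat q)^T = Mmat q ;
  Mmat_posdef : forall q (v : 'cV[R]_r),
    v != 0 -> 0 < (v^T *m Mmat q *m v) 0 0 ;
  Qmat_rank : forall q, \rank (Qmat q) = m
}.

(* x1 = psi(q), x2 = P(q) q' *)
Record coord_change (R : realType) (r : nat) := CoordChange {
  psi : 'cV[R]_r -> 'cV[R]_r ;
  psi_inv : 'cV[R]_r -> 'cV[R]_r ;
  Pmat : 'cV[R]_r -> 'M[R]_r ;
  psiK : cancel psi psi_inv ;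
  psi_invK : cancel psi_inv psi ;
  psi_smooth : smooth psi ;
  psi_inv_smooth : smooth psi_inv ;
  Pmat_smooth : smooth Pmat ;
  Pmat_unit : forall q, Pmat q \in unitmx
}.

Section ControlSystem.
Context {R : realType} {r m : nat}.
Variables (S : mech_system R r m) (C : coord_change R r).
Notation state := ('cV[R]_(r + r)).

Definition Fmat (x1 : 'cV[R]_r) : 'M[R]_r :=
  let q := psi_inv C x1 in jac (psi C) q *m invmx (Pmat C q).

Definition fhat (x1 x2 : 'cV[R]_r) : 'cV[R]_r :=
  let q := psi_inv C x1 in
  let v := invmx (Pmat C q) *m x2 in
  'D_v (Pmat C) q *m invmx (Pmat C q) *m x2 -
  Pmat C q *m invmx (Mmat S q) *m Nvec S (q, v).

Definition Ghat (x1 : 'cV[R]_r) : 'M[R]_(r, m) :=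
  let q := psi_inv C x1 in Pmat C q *m invmx (Mmat S q) *m Qmat S q.

Definition fvec (x : state) : state :=
  col_mx (Fmat (usubmx x) *m dsubmx x) (fhat (usubmx x) (dsubmx x)).

Definition gvec (i : 'I_m) (x : state) : state :=
  col_mx 0 (col i (Ghat (usubmx x))).

Definition hamiltonian (l x : state) (u : 'cV[R]_m) : R :=
  dotv l (fvec x) + \sum_i dotv l (gvec i x) * u i 0.

Variables alpha beta : 'I_m -> R.

Definition control_set : set 'cV[R]_m :=
  [set u | forall i, alpha i <= u i 0 <= beta i].

Variable T : R.

Definition admissible (u : R -> 'cV[R]_m) : Prop :=
  (forall i, lebesgue_measurable_fun `[0, T] (fun t => u t i 0)) /\
  ae_on `[0, T] (fun t => control_set (u t)).

(* Curves are total functions on R of which only the restriction to [0, T]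
   matters: the derivatives are required almost everywhere on [0, T], hence
   never at the end points, and inside ]0, T[ they are local. *)
Record extremal (lambda0 : R) (x lam : R -> state) (u : R -> 'cV[R]_m) :
    Prop := Extremal {
  ext_admissible : admissible u ;
  ext_x_ac : abs_continuous_on 0 T x ;
  ext_lam_ac : abs_continuous_on 0 T lam ;
  ext_lam_neq0 : forall t, `[0, T]%classic t -> lam t != 0 ;
  ext_x_eq : ae_on `[0, T] (fun t =>
    is_derive t 1 x (grad (fun l => hamiltonian l (x t) (u t)) (lam t))) ;
  ext_lam_eq : ae_on `[0, T] (fun t =>
    is_derive t 1 lam (- grad (fun y => hamiltonian (lam t) y (u t)) (x t))) ;
  ext_max : ae_on `[0, T] (fun t => forall v, control_set v ->
    hamiltonian (lam t) (x t) v <= hamiltonian (lam t) (x t) (u t)) ;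
  ext_const : ae_on `[0, T] (fun t =>
    hamiltonian (lam t) (x t) (u t) = lambda0) ;
  ext_lambda0 : 0 <= lambda0
}.

Definition abnormal (lambda0 : R) : Prop := lambda0 = 0.

Definition switching_fun (x lam : R -> state) (i : 'I_m) (t : R) : R :=
  dotv (lam t) (gvec i (x t)).

Definition singular_on (J : interval R) (x lam : R -> state) (i : 'I_m) :
    Prop :=
  forall t, t \in J -> switching_fun x lam i t = 0.

Definition totally_singular_on (J : interval R) (x lam : R -> state) : Prop :=
  forall i, singular_on J x lam i.

Definition regular (u : R -> 'cV[R]_m) (i : 'I_m) : Prop :=
  bang_bang T (alpha i) (beta i) (fun t => u t i 0) /\
  finite_set (switching_time T (fun t => u t i 0)).

End ControlSystem.

Section FullyActuated.
Context {R : realType} {r : nat}.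
Variables (S : mech_system R r r) (C : coord_change R r).
Notation state := ('cV[R]_(r + r)).
Notation fv := (fvec S C).
Notation gv := (gvec S C).

(* struct_coef i j k is the function alpha_ij^k defined by
     [g_j, [f, g_i]](x) = \sum_k alpha_ij^k(x) g_k(x);
   the vectors g_k(x) are linearly independent and span {0} x R^r, to which
   the bracket belongs, so that the description is a definite one. *)
Definition struct_coef (i j k : 'I_r) (x : state) : R :=
  (get [set a : 'cV[R]_r |
     lie (gv j) (lie fv (gv i)) x = \sum_l a l 0 *: gv l x]) k 0.

Definition span_cond_i (k : 'I_r) (x : state) : Prop :=
  (<<[seq gv i x | i <- enum 'I_r] ++
     [seq lie fv (gv j) x | j <- enum 'I_r & j != k] ++
     [seq ad fv 2 (gv j) x | j <- enum 'I_r & j != k]>> = fullv)%VS.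

Definition span_cond_ii (k : 'I_r) (x : state) : Prop :=
  (<<fv x :: [seq gv i x | i <- enum 'I_r] ++
     [seq lie fv (gv j) x | j <- enum 'I_r & j != k]>> = fullv)%VS.

(* Only the components w j with j != k occur. *)
Definition singular_control_system (k : 'I_r) (x l : state) (uk : R)
    (w : 'cV[R]_r) : Prop :=
  forall i, i != k ->
    let phik := dotv l (gv k x) in
    (dotv l (ad fv 2 (gv i) x) + struct_coef i k k x * phik * uk) / phik =
    - \sum_(j | j != k) struct_coef i j k x * w j 0.

Definition struct_det (k : 'I_r) (x : state) : R :=
  \det (row' k (col' k (\matrix_(i, j) struct_coef i j k x))).

End FullyActuated.

(* Main.v *)
Require Import Defs.
From HB Require Import structures.
From mathcomp Require Import all_boot all_order all_algebra.
From mathcomp Require Import all_classical all_reals all_analysis.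
From mathcomp Require Import measurable_realfun ring lra.

Set Implicit Arguments.
Unset Strict Implicit.
Unset Printing Implicit Defensive.

Import Order.TTheory GRing.Theory Num.Theory.
Import numFieldNormedType.Exports.

Local Open Scope classical_set_scope.
Local Open Scope ring_scope.

(** Write phi_i = lam . g_i(x) for the switching functions and
psi_i = lam . [f, g_i](x).  Since g_i = (0, g^_i(x1)) is vertical and depends on
the configuration x1 only, the control fields commute; since the configuration
component of [f, g_i] is - F(x1) g^_i(x1), the brackets [g_j, [f, g_i]] are vertical
([usubmx_lie_gvec_lie]).  With r controls the g_i span the vertical space, so that
those brackets are combinations of the g_k, and the 2r vectors g_i, [f, g_i] form a
basis ([gvec_lie_annihilator]).

Along an extremal, lam . Y(x) has almost everywhere the derivative
lam . [f, Y](x) + sum_j u_j lam . [g_j, Y](x) ([extremal_is_derive]).  For Y = g_i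
the controls drop out, so that phi_i is of class C^1 with derivative psi_i
([extremal_derivative_within]).  If all the phi_i vanish on an interval, so do the
psi_i, and lam annihilates a basis: this excludes totally singular extremals.  If
the phi_i with i <> k vanish identically, the same argument at a single zero of
phi_k gives psi_k <> 0 there ([switching_zero_simple]).  The zeros of phi_k are then
isolated, hence finite in number, and between them the maximum condition forces u_k
to be alpha_k or beta_k according to the sign of phi_k.

For i <> k the function psi_i vanishes identically as well, and its derivative
gives, with Y = [f, g_i],
0 = lam . ad_f^2 g_i(x) + sum_j u_j alpha_ij^k(x) phi_k almost everywhere, which is
the linear system for the singular controls.  As the controls are bounded, the same
relation shows by continuity that lam . ad_f^2 g_i(x) = 0 at a zero of phi_k; on an
abnormal extremal 0 = lam . f(x) + u_k phi_k shows in the same way that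
lam . f(x) = 0 there ([bounded_control_limit]).  Under either span condition lam
would vanish at a zero of phi_k; so phi_k keeps a constant sign and u_k is constant.

The analytic input is a mean value inequality for absolutely continuous curves
([ac_mean_value_inequality]): it makes a function with a continuous almost
everywhere derivative differentiable everywhere.  The rest is calculus: f and the
g_i are smooth, because maps of class C^n between finite-dimensional spaces are
stable under composition, matrix products and inverses. *)

(** * Real induction and mean value inequalities *)

(** The property P of subintervals holds globally as soon as it is local and
passes to concatenations: the supremum of the s with P a s cannot be smaller
than b.  This replaces every compactness argument below: mean value
inequalities, finiteness of a discrete set of zeros, constancy of a sign. *)
Lemma interval_induction {R : realType} (P : R -> R -> Prop) (a b : R) :
  a <= b ->
  (forall c d e, c <= d -> d <= e -> P c d -> P d e -> P c e) ->
  (forall p, a <= p <= b -> exists2 r : R, 0 < r & forall c d,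
     a <= c -> c <= p -> p <= d -> d <= b -> p - r < c -> d < p + r -> P c d) ->
  P a b.
Proof.
move=> ab trP locP.
pose E := [set s | a <= s <= b /\ P a s].
have Ea : E a.
  split; first by rewrite lexx.
  have [|r r0 H] := locP a; first by rewrite lexx.
  by apply: H => //; lra.
have hE : has_sup E by split; [exists a|exists b => s [/andP[]]].
have [ap pb] : a <= sup E /\ sup E <= b.
  split; first exact: ub_le_sup hE.2 _ Ea.
  by apply: ge_sup; [exists a|move=> s [/andP[]]].
have [|r r0 H] := locP (sup E); first by rewrite ap.
have [c [/andP[ac cb] Pc] pc] := sup_adherent r0 hE.
have cp : c <= sup E by apply: ub_le_sup hE.2 _ _; split=> //; rewrite ac.
pose d : R := Num.min (sup E + r / 2) b.
have pd : sup E <= d by rewrite /d le_min pb andbT; lra.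
have db : d <= b by rewrite /d ge_min lexx orbT.
have dr : d < sup E + r by rewrite /d gt_min; apply/orP; left; lra.
have Pd : P a d by apply: (trP a c d) => //; [exact: le_trans pd|exact: H].
have dp : d <= sup E.
  by apply: ub_le_sup hE.2 _ _; split=> //; rewrite db (le_trans ap pd).
suff <- : d = b by [].
by move: dp; rewrite /d; case: (leP (sup E + r / 2) b) => *; lra.
Qed.

Lemma is_derive_growth {R : realType} {V : normedModType R} (G : R -> V) (p : R)
    (v : V) (e : R) :
  is_derive p 1 G v -> 0 < e -> exists2 r : R, 0 < r & forall s, `|s - p| < r ->
    `|G s - G p - (s - p) *: v| <= e * `|s - p|.
Proof.
move=> [dG <-] e0.
move: dG => /cvgrPdist_le /(_ e e0)/= /nbhs_ballP[r /= r0 H]; exists r => // s sr.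
have [->|sp] := eqVneq s p; first by rewrite !subrr scale0r subrr !normr0 mulr0.
have sp0 : s - p != 0 by rewrite subr_eq0.
have /= := H (s - p); rewrite /ball/= sub0r normrN => /(_ sr sp0).
rewrite [(s - p)%:A]mulr1 subrK -/(derive G p 1) => Hs.
rewrite -ler_pdivrMr ?normr_gt0// -normfV mulrC -normrZ -[X in X <= _]normrN.
by apply: le_trans Hs; rewrite scalerBr opprB scalerA mulVf// scale1r.
Qed.

(** The interval [c, d] contains p but need not end there: this is the local
step of [interval_induction]. *)
Lemma is_derive_increment {R : realType} {V : normedModType R} (G : R -> V)
    (p : R) (v : V) (K e : R) :
  is_derive p 1 G v -> `|v| <= K -> 0 < e ->
  exists2 r : R, 0 < r & forall c d, c <= p -> p <= d -> p - r < c -> d < p + r ->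
    `|G d - G c| <= (K + e) * (d - c).
Proof.
move=> dG vK e0; have [r r0 H] := is_derive_growth dG e0.
exists r => // c d cp pd rc dr.
have half s : `|s - p| < r -> `|G s - G p| <= (K + e) * `|s - p|.
  move=> /H Hs; rewrite -[G s - G p](subrK ((s - p) *: v)).
  rewrite (le_trans (ler_normD _ _))// addrC mulrDl lerD// normrZ mulrC.
  exact: ler_wpM2r.
have Hd : `|d - p| < r by rewrite ger0_norm; lra.
have Hc : `|c - p| < r by rewrite ler0_norm; lra.
rewrite -(subrKA (G p)) (le_trans (ler_normD _ _))// [`|G p - _|]distrC.
have := lerD (half _ Hd) (half _ Hc).
rewrite (ger0_norm (_ : 0 <= d - p)) ?subr_ge0// (ler0_norm (_ : c - p <= 0)) ?subr_le0//.
move=> /le_trans; apply; rewrite -mulrDr le_eqVlt; apply/orP; left; apply/eqP.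
by congr (_ * _); lra.
Qed.

Lemma mean_value_inequality {R : realType} {V : normedModType R} (a b K : R)
    (G : R -> V) : a <= b ->
  (forall t, a <= t <= b -> exists2 v, is_derive t 1 G v & `|v| <= K) ->
  `|G b - G a| <= K * (b - a).
Proof.
move=> ab dG; apply/ler_addgt0Pr => e e0.
have e'0 : 0 < e / (b - a + 1) by rewrite divr_gt0//; lra.
set e' := e / _ in e'0.
have : `|G b - G a| <= (K + e') * (b - a).
  apply: (@interval_induction _ (fun c d => `|G d - G c| <= (K + e') * (d - c)) a b ab).
    move=> c d f _ _ cd df; rewrite -(subrKA (G d)) (le_trans (ler_normD _ _))//.
    by rewrite (le_trans (lerD df cd))// -mulrDr subrKA.
  move=> p pab; have [v dv vK] := dG _ pab.
  by have [r r0 H] := is_derive_increment dv vK e'0; exists r => // c d *; apply: H.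
move=> /le_trans; apply; rewrite mulrDl lerD2l /e' mulrAC ler_pdivrMr; last lra.
by rewrite ler_pM2l//; lra.
Qed.

(** * Absolutely continuous curves *)

(** The families of intervals on which absolute continuity is tested, with the
additional requirement that the intervals lie in a given open set U. *)
Definition interval_family {R : realType} (U : set R) (a b : R) (n : nat)
    (c : 'I_n -> R * R) :=
  (forall i, [/\ a <= (c i).1, (c i).1 <= (c i).2, (c i).2 <= b
    & `](c i).1, (c i).2[%classic `<=` U]) /\
  trivIset setT (fun i => `](c i).1, (c i).2[%classic).

Lemma interval_family_length {R : realType} (U : set R) (a b : R) n
    (c : 'I_n -> R * R) (l : R) : open U -> (lebesgue_measure U < l%:E)%E ->
  interval_family U a b c -> \sum_i ((c i).2 - (c i).1) < l.
Proof.
move=> oU Ul [cU tc]; rewrite -lte_fin; apply: le_lt_trans Ul.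
rewrite -sumEFin.
have -> : (\sum_(i < n) ((c i).2 - (c i).1)%:E)%E =
    (\sum_(i < n) lebesgue_measure (`](c i).1, (c i).2[%classic : set R))%E.
  apply: eq_bigr => i _; have [_ ci _ _] := cU i.
  rewrite lebesgue_measure_itv/= lte_fin; case: ltP => // ci'.
  by rewrite (_ : (c i).2 = (c i).1) ?subrr//; apply/le_anti; rewrite ci ci'.
rewrite -measure_semi_additive_ord//.
- apply: le_measure; rewrite ?inE.
  + by apply: bigsetU_measurable => i _; exact: measurable_itv.
  + exact: open_measurable.
  + elim/big_ind: _ => [|A B AU BU|i _]; [exact: sub0set|by rewrite subUset|].
    by have [_ _ _] := cU i.
- by apply: bigsetU_measurable => i _; exact: measurable_itv.
Qed.

Lemma interval_family_cat {R : realType} {V : normedModType R} (G : R -> V)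
    (U : set R) (a b d : R) n m (c1 : 'I_n -> R * R) (c2 : 'I_m -> R * R) :
  a <= b -> b <= d -> interval_family U a b c1 -> interval_family U b d c2 ->
  exists k (c : 'I_k -> R * R), interval_family U a d c /\
    \sum_i `|G (c i).2 - G (c i).1| =
    \sum_i `|G (c1 i).2 - G (c1 i).1| + \sum_i `|G (c2 i).2 - G (c2 i).1|.
Proof.
move=> ab bd [c1U t1] [c2U t2].
pose c i := match fintype.split i with inl j => c1 j | inr j => c2 j end.
have cl i : c (lshift m i) = c1 i by rewrite /c (unsplitK (inl i)).
have cr i : c (rshift n i) = c2 i by rewrite /c (unsplitK (inr i)).
exists (n + m)%N, c; split; last first.
  by rewrite big_split_ord/=; congr (_ + _); apply: eq_bigr => i _; rewrite ?cl ?cr.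
split.
  move=> i; case: (split_ordP i) => j ->.
  - by rewrite cl; have [? ? ? ?] := c1U j; split=> //; apply: le_trans bd.
  - by rewrite cr; have [? ? ? ?] := c2U j; split=> //; apply: le_trans ab _.
have disj i j s : ~ (`](c1 i).1, (c1 i).2[%classic s /\ `](c2 j).1, (c2 j).2[%classic s).
  have [_ _ h1 _] := c1U i; have [h2 _ _ _] := c2U j.
  by rewrite /= !in_itv/= => -[/andP[_ h3] /andP[h4 _]]; lra.
move=> i j _ _ [s]; case: (split_ordP i) => i' ->; case: (split_ordP j) => j' ->;
    rewrite ?cl ?cr => -[h1 h2].
- by congr lshift; apply: t1 => //; exists s.
- by case: (disj i' j' s).
- by case: (disj j' i' s).
- by congr rshift; apply: t2 => //; exists s.
Qed.

(** The exceptional null set N is covered by an open set U so small that the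
variation of G over disjoint intervals in U is below e / 2.  An interval around a
point outside N obeys the mean value inequality up to a small slope e'; an
interval around a point of N lies in U.  Real induction is thus applied to the
mean value inequality corrected by the variation of G over some family of
intervals contained in U: such families can be concatenated. *)
Lemma ac_mean_value_inequality {R : realType} {V : normedModType R} (a b K : R)
    (G : R -> V) : a <= b -> 0 <= K -> abs_continuous_on a b G ->
  ae_on `[a, b] (fun t => exists2 v, is_derive t 1 G v & `|v| <= K) ->
  `|G b - G a| <= K * (b - a).
Proof.
move=> ab K0 acG aeG; apply/ler_addgt0Pr => e e0.
have e20 : 0 < e / 2 by lra.
have e'0 : 0 < e / 2 / (b - a + 1) by rewrite divr_gt0//; lra.
(* Half of e pays for the slope e' over the length of [a, b], the other half for
the variation of G over the intervals in U. *)
set e' := e / 2 / _ in e'0.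
have [l l0 Hl] := acG _ e20.
have [N [mN N0 subN]] := aeG.
have [|U [oU NU Ul]] := @lebesgue_regularity_outer R N l mN _ l0.
  by rewrite [X in (X < _)%E]N0 ltry.
have {}Ul : (lebesgue_measure U < l%:E)%E.
  have -> : U = N `|` U `\` N by rewrite setDUK.
  rewrite measureU//; first by rewrite [X in (X + _ < _)%E]N0 add0e.
  - by apply: measurableD => //; exact: open_measurable.
  - by rewrite setDIK.
pose P c d := exists n (f : 'I_n -> R * R), interval_family U c d f /\
  `|G d - G c| <= (K + e') * (d - c) + \sum_i `|G (f i).2 - G (f i).1|.
suff [n [f [fU Gf]]] : P a b.
  have lf := interval_family_length oU Ul fU.
  have /ltW sf : \sum_i `|G (f i).2 - G (f i).1| < e / 2.
    by apply: Hl lf => [i|]; [have [? ? ? _] := fU.1 i|exact: fU.2].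
  apply: le_trans Gf _; rewrite mulrDl -addrA lerD2l.
  rewrite [leRHS](splitr e) lerD// /e' mulrAC ler_pdivrMr; last lra.
  by rewrite ler_pM2l//; lra.
apply: interval_induction ab _ _.
  move=> c d s cd ds [n [f [fU Gf]]] [m [g [gU Gg]]].
  have [k [h [hU hE]]] := interval_family_cat G cd ds fU gU.
  exists k, h; split=> //; rewrite hE -(subrKA (G d)) (le_trans (ler_normD _ _))//.
  by rewrite (le_trans (lerD Gg Gf))// le_eqVlt; apply/orP; left; apply/eqP; ring.
move=> p pab.
have [Np|Np] := pselect (N p).
  have /nbhs_ballP[r/= r0 rU] := open_nbhs_nbhs (conj oU (NU _ Np)).
  exists r => // c d ac cp pd db rc dr.
  (* The interval [c, d] itself is the family. *)
  exists 1%N, (fun=> (c, d)); split; last first.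
    rewrite big_ord1/= lerDr mulr_ge0//; lra.
  split=> [_|i j _ _ _]; last by rewrite (ord1 i) (ord1 j).
  split; rewrite ?lexx//=; first lra.
  move=> s /=; rewrite in_itv/= => /andP[? ?]; apply: rU.
  by rewrite /ball/= ltr_norml; apply/andP; split; lra.
have [v dv vK] : exists2 v, is_derive p 1 G v & `|v| <= K.
  apply: contrapT => H; apply/Np/subN => /= H1; apply/H/H1.
  by rewrite in_itv.
have [r r0 H] := is_derive_increment dv vK e'0.
exists r => // c d ac cp pd db rc dr.
exists 0%N, (fun=> (c, d)); split; last by rewrite big_ord0 addr0 H.
by split=> [i|i]; have := ltn_ord i.
Qed.

(** One statement for three closure properties: images under Lipschitz maps
(F = G), sums, and maps of two absolutely continuous arguments. *)
Lemma abs_continuous_dominated {R : realType} {V W X : normedModType R} (a b L : R)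
    (F : R -> V) (G : R -> W) (H : R -> X) :
  abs_continuous_on a b F -> abs_continuous_on a b G ->
  (forall s t, a <= s -> s <= t -> t <= b ->
     `|H t - H s| <= L * (`|F t - F s| + `|G t - G s|)) ->
  abs_continuous_on a b H.
Proof.
move=> acF acG dom e e0.
have L0 : 0 < `|L| + 1 by rewrite ltr_pwDr.
have e'0 : 0 < e / 2 / (`|L| + 1) by rewrite !divr_gt0.
have [d d0 Hd] := acF _ e'0; have [d' d'0 Hd'] := acG _ e'0.
exists (Num.min d d') => [|n c cab tc]; first by rewrite lt_min d0.
rewrite lt_min => /andP[cd cd'].
have /le_lt_trans : \sum_i `|H (c i).2 - H (c i).1| <= (`|L| + 1) *
    (\sum_i `|F (c i).2 - F (c i).1| + \sum_i `|G (c i).2 - G (c i).1|).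
  rewrite -big_split/= mulr_sumr; apply: ler_sum => i _.
  have [ai [ci bi]] := cab i; apply: le_trans (dom _ _ ai ci bi) _.
  by rewrite ler_wpM2r ?addr_ge0// (le_trans (ler_norm L))// lerDl.
apply; rewrite mulrC -ltr_pdivlMr// [ltRHS](_ : _ =
  e / 2 / (`|L| + 1) + e / 2 / (`|L| + 1)); last by rewrite -mulrDl -splitr.
by apply: ltrD; [apply: Hd|apply: Hd'].
Qed.

Lemma abs_continuous_id {R : realType} (a b : R) :
  abs_continuous_on a b (id : R -> R).
Proof.
move=> e e0; exists e => // n c cab _; apply: le_lt_trans.
rewrite le_eqVlt; apply/orP; left; apply/eqP; apply: eq_bigr => i _ /=.
by have [_ [ci _]] := cab i; rewrite ger0_norm// subr_ge0.
Qed.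

Lemma abs_continuousS {R : realType} {V : normedModType R} (a b c d : R)
    (F : R -> V) : a <= c -> d <= b ->
  abs_continuous_on a b F -> abs_continuous_on c d F.
Proof.
move=> ac db acF e /acF[l l0 H]; exists l => // n f cab; apply: H => i.
by have [? [? ?]] := cab i; split; [lra|split=> //; lra].
Qed.

Lemma abs_continuous_cvg {R : realType} {V : normedModType R} (a b t : R)
    (F : R -> V) : a <= t <= b -> abs_continuous_on a b F ->
  F s @[s --> within `[a, b] (nbhs t)] --> F t.
Proof.
move=> /andP[at_ tb] acF; apply/cvgrPdist_lt => e e0.
have [d d0 H] := acF _ e0.
have one s s' : a <= s -> s <= s' -> s' <= b -> s' - s < d -> `|F s' - F s| < e.
  move=> as_ ss sb sd; have := H 1%N (fun=> (s, s')).
  rewrite !big_ord1/=; apply=> // i j _ _ _; by rewrite (ord1 i) (ord1 j).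
rewrite near_withinE; apply/nbhs_ballP; exists d => //= s.
rewrite /ball/= in_itv/= ltr_norml => /andP[h1 h2] /andP[as_ sb].
by have [st|ts] := leP s t; [|rewrite distrC]; apply: one => //; lra.
Qed.

Lemma ae_onS {R : realType} (D D' : set R) (A B : R -> Prop) :
  D' `<=` D -> (forall t, D' t -> A t -> B t) -> ae_on D A -> ae_on D' B.
Proof.
move=> DD AB; apply: (@filterS _ _ (ae_filter_ringOfSetsType _)) => t At D't.
by apply: AB => //; exact/At/DD.
Qed.

Lemma ae_onI {R : realType} (D : set R) (A B : R -> Prop) :
  ae_on D A -> ae_on D B -> ae_on D (fun t => A t /\ B t).
Proof.
apply: (@filterS2 _ _ (ae_filter_ringOfSetsType _)) => t At Bt Dt.
by split; [exact: At|exact: Bt].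
Qed.

Lemma ae_on_forall {R : realType} (I : finType) (D : set R) (A : I -> R -> Prop) :
  (forall i, ae_on D (A i)) -> ae_on D (fun t => forall i, A i t).
Proof.
move=> aeA; have aeF := ae_filter_ringOfSetsType (@lebesgue_measure R).
apply: (@filterS _ _ aeF (fun t => forall i, D t -> A i t)) => [t At Dt i|].
  exact: At.
exact: (@filter_forall _ I (fun i t => D t -> A i t) _ aeF).
Qed.

(** One-sided at the ends of [a, b], because the values of h outside of [a, b] are
arbitrary. *)
Definition derivative_within {R : realType} (a b : R) (h : R -> R) (t c : R) :=
  forall e : R, 0 < e ->
    \forall s \near within `[a, b] (nbhs t), `|h s - h t - (s - t) * c| <= e * `|s - t|.

(** If the almost everywhere derivative c of an absolutely continuous function h
is continuous at t, then h is differentiable at t: near t the function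
h - (c t) * id has an almost everywhere derivative of size at most e, so that the
mean value inequality bounds its increments. *)
Lemma ae_derivative_within {R : realType} (a b t : R) (h c : R -> R) :
  a <= t <= b ->
  (exists2 r : R, 0 < r & forall s1 s2, a <= s1 -> s2 <= b -> t - r < s1 ->
     s2 < t + r -> abs_continuous_on s1 s2 h) ->
  ae_on `[a, b] (fun s => is_derive s 1 h (c s)) ->
  c s @[s --> within `[a, b] (nbhs t)] --> c t ->
  derivative_within a b h t (c t).
Proof.
move=> /andP[at_ tb] [r r0 ach] aeh /cvgrPdist_le cc e e0.
have := cc e e0; rewrite near_withinE => /nbhs_ballP[r' /= r'0 Hc].
rewrite near_withinE; apply/nbhs_ballP; exists (Num.min r r') => /=.
  by rewrite lt_min r0.
move=> s; rewrite /ball/= in_itv/= lt_min => /andP[sr sr'] /andP[as_ sb].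
have key s1 s2 : a <= s1 -> s1 <= s2 -> s2 <= b -> t - r < s1 -> s2 < t + r ->
    t - r' < s1 -> s2 < t + r' ->
    `|h s2 - h s1 - (s2 - s1) * c t| <= e * (s2 - s1).
  move=> as1 s12 s2b h1 h2 h3 h4; pose G u := h u - u * c t.
  have -> : h s2 - h s1 - (s2 - s1) * c t = G s2 - G s1 by rewrite /G; ring.
  apply: ac_mean_value_inequality => //; first exact: ltW.
    apply: (@abs_continuous_dominated _ _ _ _ _ _ (`|c t| + 1) h id)
      (ach _ _ as1 s2b h1 h2) (@abs_continuous_id _ _ _) _.
    move=> u v _ _ _; rewrite /G.
    have -> : h v - v * c t - (h u - u * c t) = (h v - h u) - (v - u) * c t by ring.
    rewrite (le_trans (ler_normB _ _))// normrM mulrDr lerD//.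
      by rewrite ler_peMl// lerDr.
    by rewrite mulrC ler_wpM2r// lerDl.
  have sub u : `[s1, s2]%classic u -> `[a, b]%classic u.
    by rewrite /= !in_itv/= => /andP[? ?]; apply/andP; split; lra.
  apply: (ae_onS sub _ aeh) => u uc hu.
  have : `[a, b]%classic u by exact: sub.
  move: uc; rewrite /= !in_itv/= => /andP[s1u us2] uab.
  exists (c u - c t).
    rewrite /G.
    have -> : (fun u => h u - u * c t) = h - (fun u => u *: c t) by apply/funext.
    apply: is_deriveB.
    rewrite (_ : *:%R^~ (c t) = c t *: id); last first.
      by apply/funext => v /=; rewrite /GRing.scale/= mulrC.
    by apply: is_derive_eq; rewrite /GRing.scale/= mulr1.
  by rewrite distrC; apply: Hc => //; rewrite /ball/= ltr_norml; apply/andP; split; lra.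
move: sr sr'; rewrite !ltr_norml => /andP[? ?] /andP[? ?].
have [st|ts] := leP s t.
  have <- : `|h t - h s - (t - s) * c t| = `|h s - h t - (s - t) * c t|.
    by rewrite -normrN; congr (`|_|); ring.
  rewrite [`|s - t|]distrC (ger0_norm (_ : 0 <= t - s)) ?subr_ge0//.
  by apply: key => //; lra.
by rewrite (ger0_norm (_ : 0 <= s - t)) ?subr_ge0 ?(ltW ts)//; apply: key => //; lra.
Qed.

(** * Maps of class C^n between finite-dimensional spaces *)

Section ClassC.
Context {R : realType}.
Implicit Types V W X : normedModType R.

Lemma of_class_C_continuous V W n (F : V -> W) : of_class_C n F -> continuous F.
Proof. by case: n => [//|n] [dF _] x; exact: differentiable_continuous. Qed.

Lemma of_class_C_pred V W n (F : V -> W) : of_class_C n.+1 F -> of_class_C n F.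
Proof.
elim: n F => [|n IHn] F; first exact: of_class_C_continuous.
by move=> [dF CF]; split=> // v; apply: IHn.
Qed.

Lemma of_class_C_cst V W n (w : W) : of_class_C n (fun _ : V => w).
Proof.
elim: n w => [|n IHn] w; first by move=> x; exact: cvg_cst.
split=> [x|v]; first exact: differentiable_cst.
by rewrite (_ : 'D_v _ = fun=> 0)//; apply/funext => x; rewrite derive_cst.
Qed.

Lemma of_class_CD V W n (F G : V -> W) : of_class_C n F -> of_class_C n G ->
  of_class_C n (fun x => F x + G x).
Proof.
elim: n F G => [|n IHn] F G.
  by move=> cF cG x; apply: cvgD; [exact: cF|exact: cG].
move=> [dF CF] [dG CG]; split=> [x|v]; first exact: differentiableD.
rewrite (_ : 'D_v _ = fun x => 'D_v F x + 'D_v G x).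
  by apply: IHn; [exact: CF|exact: CG].
by apply/funext => x; rewrite -deriveD//; exact: diff_derivable.
Qed.

Lemma of_class_C_sum V W (I : finType) n (F : I -> V -> W) :
  (forall i, of_class_C n (F i)) -> of_class_C n (fun x => \sum_i F i x).
Proof.
move=> CF; elim: (index_enum I) => [|i s IHs].
  rewrite (_ : (fun _ => _) = fun=> 0); first exact: of_class_C_cst.
  by apply/funext => x; rewrite big_nil.
rewrite (_ : (fun _ => _) = fun x => F i x + \sum_(j <- s) F j x).
  exact: of_class_CD.
by apply/funext => x; rewrite big_cons.
Qed.

Lemma of_class_C_linear V W X n (L : {linear W -> X}) (F : V -> W) :
  continuous L -> of_class_C n F -> of_class_C n (fun x => L (F x)).
Proof.
move=> cL; elim: n F => [|n IHn] F.
  by move=> cF x; apply: (continuous_comp (cF x)); exact: cL.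
move=> [dF CF]; have dL y : differentiable L y by exact: linear_differentiable.
split=> [x|v]; first exact: (differentiable_comp (dF x)).
rewrite (_ : 'D_v _ = fun x => L ('D_v F x)); first by apply: IHn; exact: CF.
apply/funext => x; rewrite !deriveE//; last exact: (differentiable_comp (dF x)).
by rewrite (diff_comp (dF x) (dL _))/= diff_lin.
Qed.

Lemma of_class_C_scalel V W n (a : V -> R) (w : W) :
  of_class_C n a -> of_class_C n (fun x => a x *: w).
Proof.
elim: n a => [|n IHn] a; first by move=> ca x; apply: cvgZr_tmp; exact: ca.
move=> [da Ca]; split=> [x|v]; first exact: differentiableZl.
rewrite (_ : 'D_v _ = fun x => 'D_v a x *: w); first by apply: IHn; exact: Ca.
by apply/funext => x; rewrite !deriveE ?diffZl//; exact: differentiableZl.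
Qed.

Lemma of_class_CM V n (a b : V -> R) :
  of_class_C n a -> of_class_C n b -> of_class_C n (fun x => a x * b x).
Proof.
elim: n a b => [|n IHn] a b; first by move=> ca cb x; apply: cvgM; [exact: ca|exact: cb].
move=> Ca Cb; have [da C'a] := Ca; have [db C'b] := Cb.
split=> [x|v]; first exact: differentiableM.
rewrite (_ : 'D_v _ = fun x => a x * 'D_v b x + b x * 'D_v a x).
  apply: of_class_CD; apply: IHn; [|exact: C'b| |exact: C'a];
    exact: of_class_C_pred.
by apply/funext => x; rewrite -[LHS]/('D_v (a * b) x) deriveM//; exact: diff_derivable.
Qed.

Lemma of_class_CV V n (a : V -> R) : (forall x, a x != 0) ->
  of_class_C n a -> of_class_C n (fun x => (a x)^-1).
Proof.
move=> a0; elim: n => [|n IHn] Ca; first by move=> x; apply: cvgV => //; exact: Ca.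
have [da C'a] := Ca; have CV := IHn (of_class_C_pred Ca).
split=> [x|v]; first exact: differentiableV.
rewrite (_ : 'D_v _ = fun x => (a x)^-1 * (a x)^-1 * (-1 * 'D_v a x)).
  apply: of_class_CM; first exact: of_class_CM.
  by apply: of_class_CM; [exact: of_class_C_cst|exact: C'a].
apply/funext => x; rewrite deriveE; last exact: differentiableV.
by rewrite diffV//= -deriveE// /GRing.scale/= -exprVn expr2; ring.
Qed.

(** The part of finite-dimensionality that the calculus uses: it turns a
differential into a finite combination of the directional derivatives by which
the class C^n is defined.  Matrix spaces and their products have such families. *)
Definition frame V (I : finType) (e : I -> V) (l : I -> {linear V -> R}) :=
  (forall i, continuous (l i)) /\ forall v, v = \sum_i l i v *: e i.

Definition framed V := exists (I : finType) (e : I -> V) (l : I -> {linear V -> R}),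
  frame e l.

Lemma of_class_C_coord V W (I : finType) (e : I -> W) (l : I -> {linear W -> R})
    n (F : V -> W) : frame e l ->
  (forall i, of_class_C n (fun x => l i (F x))) -> of_class_C n F.
Proof.
move=> [_ lE] CF; rewrite (_ : F = fun x => \sum_i l i (F x) *: e i).
  by apply: of_class_C_sum => i; exact: of_class_C_scalel.
by apply/funext => x; exact: lE.
Qed.

Lemma of_class_CZ V W n (a : V -> R) (F : V -> W) : framed W ->
  of_class_C n a -> of_class_C n F -> of_class_C n (fun x => a x *: F x).
Proof.
move=> [I [e [l fr]]] Ca CF; apply: (of_class_C_coord fr) => i.
rewrite (_ : (fun _ => _) = fun x => a x * l i (F x)).
  by apply: of_class_CM => //; apply: of_class_C_linear => //; have [+ _] := fr.
by apply/funext => x; rewrite linearZ.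
Qed.

Lemma diff_frame V W (I : finType) (e : I -> V) (l : I -> {linear V -> R})
    (F : V -> W) x v : frame e l -> differentiable F x ->
  'd F x v = \sum_i l i v *: 'D_(e i) F x.
Proof.
move=> [_ lE] dF; rewrite {1}(lE v) linear_sum; apply: eq_bigr => i _.
by rewrite linearZ deriveE.
Qed.

(** By the chain rule, D_v (G o F) = sum_i l_i (D_v F) *: (D_(e_i) G o F) in a
frame (e, l) of the middle space; the factors are of class C^n by induction. *)
Lemma of_class_C_comp V W X n (F : V -> W) (G : W -> X) : framed W -> framed X ->
  of_class_C n F -> of_class_C n G -> of_class_C n (fun x => G (F x)).
Proof.
move=> fW fX; have [I [e [l fr]]] := fW.
elim: n F G => [|n IHn] F G CF CG.
  by move=> x; apply: (continuous_comp (CF x)); exact: CG.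
have [dF C'F] := CF; have [dG C'G] := CG.
split=> [x|v]; first exact: (differentiable_comp (dF x)).
rewrite (_ : 'D_v _ = fun x => \sum_i l i ('D_v F x) *: 'D_(e i) G (F x)).
  apply: of_class_C_sum => i; apply: of_class_CZ => //.
    by apply: of_class_C_linear; [have [+ _] := fr|exact: C'F].
  by apply: (IHn F ('D_(e i) G)); [exact: of_class_C_pred|exact: C'G].
apply/funext => x; rewrite -(diff_frame _ fr)// deriveE; last first.
  exact: (differentiable_comp (dF x)).
by rewrite (diff_comp (dF x) (dG _))/= (deriveE _ (dF x)).
Qed.

Lemma of_class_C_diff V W X n (F : W -> X) (Y Z : V -> W) : framed W -> framed X ->
  of_class_C n.+1 F -> of_class_C n Y -> of_class_C n Z ->
  of_class_C n (fun x => 'd F (Y x) (Z x)).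
Proof.
move=> fW fX [dF CF] CY CZ; have [I [e [l fr]]] := fW.
rewrite (_ : (fun _ => _) = fun x => \sum_i l i (Z x) *: 'D_(e i) F (Y x)).
  apply: of_class_C_sum => i; apply: of_class_CZ => //.
    by apply: of_class_C_linear => //; have [+ _] := fr.
  by apply: (of_class_C_comp (G := 'D_(e i) F)) => //; exact: CF.
by apply/funext => x; rewrite -(diff_frame _ fr).
Qed.

End ClassC.

Section Frames.
Context {R : realType}.

Definition mx_coord m n (ij : 'I_m * 'I_n) (A : 'M[R]_(m, n)) : R := A ij.1 ij.2.

Fact mx_coord_is_linear m n (ij : 'I_m * 'I_n) : linear (mx_coord ij).
Proof. by move=> a A B; rewrite /mx_coord !mxE. Qed.

HB.instance Definition _ m n (ij : 'I_m * 'I_n) :=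
  GRing.isLinear.Build R 'M[R]_(m, n) R *%R (mx_coord ij) (mx_coord_is_linear ij).

Lemma mx_coord_continuous m n (ij : 'I_m * 'I_n) : continuous (mx_coord ij).
Proof. exact: coord_continuous. Qed.

Lemma frame_mx m n :
  frame (fun ij : 'I_m * 'I_n => delta_mx ij.1 ij.2 : 'M[R]_(m, n)) (@mx_coord m n).
Proof.
split=> [ij|A]; first exact: mx_coord_continuous.
by rewrite {1}(matrix_sum_delta A) pair_big.
Qed.

Lemma framed_mx m n : framed 'M[R]_(m, n).
Proof. by do 3!eexists; exact: frame_mx. Qed.

Lemma framed_prod (V W : normedModType R) : framed V -> framed W -> framed (V * W)%type.
Proof.
move=> [I [e [l [cl lE]]]] [J [f [k [ck kE]]]].
exists (I + J)%type, (fun i => match i with inl i => (e i, 0) | inr j => (0, f j) end).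
exists (fun i => match i with inl i => (l i \o fst : {linear (V * W)%type -> R})
  | inr j => (k j \o snd : {linear (V * W)%type -> R}) end).
split=> [[i|j]|[v w]].
- by move=> x; apply: (@continuous_comp _ _ _ fst (l i)); [exact: cvg_fst|exact: cl].
- by move=> x; apply: (@continuous_comp _ _ _ snd (k j)); [exact: cvg_snd|exact: ck].
- rewrite big_sumType/=.
  apply: injective_projections; rewrite /= !(raddfD, raddf_sum)/=.
    by rewrite [X in _ + X]big1 ?addr0 => [|j _]; [exact: lE|rewrite scaler0].
  by rewrite [X in X + _]big1 ?add0r => [|j _]; [exact: kE|rewrite scaler0].
Qed.

End Frames.

Section MatrixCalculus.
Context {R : realType} {V : normedModType R}.

Lemma of_class_C_mx k m n (F : V -> 'M[R]_(m, n)) :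
  (forall i j, of_class_C k (fun x => F x i j)) -> of_class_C k F.
Proof. by move=> CF; apply: (of_class_C_coord (frame_mx m n)) => -[i j]; exact: CF. Qed.

Lemma of_class_C_entry k m n (F : V -> 'M[R]_(m, n)) i j :
  of_class_C k F -> of_class_C k (fun x => F x i j).
Proof.
exact: (of_class_C_linear (L := mx_coord (i, j)) (@mx_coord_continuous _ _ _ (i, j))).
Qed.

Lemma of_class_C_mulmx k m n p (F : V -> 'M[R]_(m, n)) (G : V -> 'M[R]_(n, p)) :
  of_class_C k F -> of_class_C k G -> of_class_C k (fun x => F x *m G x).
Proof.
move=> CF CG; apply: of_class_C_mx => i j.
rewrite (_ : (fun _ => _) = fun x => \sum_l F x i l * G x l j).
  by apply: of_class_C_sum => l; apply: of_class_CM; exact: of_class_C_entry.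
by apply/funext => x; rewrite mxE.
Qed.

Lemma of_class_C_prod (I : finType) k (F : I -> V -> R) :
  (forall i, of_class_C k (F i)) -> of_class_C k (fun x => \prod_i F i x).
Proof.
move=> CF; elim: (index_enum I) => [|i s IHs].
  rewrite (_ : (fun _ => _) = fun=> 1); first exact: of_class_C_cst.
  by apply/funext => x; rewrite big_nil.
rewrite (_ : (fun _ => _) = fun x => F i x * \prod_(j <- s) F j x).
  exact: of_class_CM.
by apply/funext => x; rewrite big_cons.
Qed.

Lemma of_class_C_det k n (F : V -> 'M[R]_n) :
  of_class_C k F -> of_class_C k (fun x => \det (F x)).
Proof.
move=> CF; apply: of_class_C_sum => s; apply: of_class_CM; first exact: of_class_C_cst.
by apply: of_class_C_prod => i; exact: of_class_C_entry.
Qed.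

(** Cramer's rule makes the entries of the inverse rational functions of those
of the matrix. *)
Lemma of_class_C_invmx k n (F : V -> 'M[R]_n) : (forall x, F x \in unitmx) ->
  of_class_C k F -> of_class_C k (fun x => invmx (F x)).
Proof.
move=> uF CF; apply: of_class_C_mx => i j.
rewrite (_ : (fun _ => _) = fun x =>
    (\det (F x))^-1 * ((-1) ^+ (j + i) * \det (row' j (col' i (F x))))).
  apply: of_class_CM.
    apply: of_class_CV; last exact: of_class_C_det.
    by move=> x; rewrite -unitfE; exact: uF.
  apply: of_class_CM; first exact: of_class_C_cst.
  apply: of_class_C_det; apply: of_class_C_mx => a b.
  rewrite (_ : (fun _ => _) = fun x => F x (lift j a) (lift i b)).
    exact: of_class_C_entry.
  by apply/funext => x; rewrite !mxE.
by apply/funext => x; rewrite /invmx uF !mxE.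
Qed.

End MatrixCalculus.

Lemma is_derive_diff_comp {R : realType} {V W : normedModType R} (F : V -> W)
    (g : R -> V) (t : R) (v : V) : differentiable F (g t) ->
  is_derive t 1 g v -> is_derive t 1 (F \o g) ('d F (g t) v).
Proof.
move=> dF [/derivable1_diffP dg <-].
have dFg : differentiable (F \o g) t by exact: differentiable_comp.
split; first exact/derivable1_diffP.
by rewrite !deriveE// diff_comp.
Qed.

(** The partial derivatives are bounded near p, and the mean value inequality
applies to F along the segment from v to w. *)
Lemma locally_lipschitz {R : realType} {V W : normedModType R} (F : V -> W) (p : V) :
  framed V -> of_class_C 1 F ->
  exists2 L : R, 0 <= L & exists2 r : R, 0 < r &
    forall v w, `|v - p| < r -> `|w - p| < r -> `|F w - F v| <= L * `|w - v|.
Proof.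
move=> [I [e [l [cl lE]]]] [dF CF].

have /choice[k Hk] : forall i, exists k : R, 0 < k /\ forall x, `|l i x| <= k * `|x|.
  by move=> i; have [k k0 kP] := linear_lipschitz (cl i); exists k.
have near_p : \forall q \near p, forall i, `|'D_(e i) F q| <= `|'D_(e i) F p| + 1.
  apply: filter_forall => i; have /cvgrPdist_le/(_ 1 ltr01) := CF (e i) p.
  apply: filterS => q; rewrite -lerBlDl; apply: le_trans.
  by rewrite distrC; exact: lerB_dist.
have /nbhs_ballP[r /= r0 Hr] := near_p.
exists (\sum_i k i * (`|'D_(e i) F p| + 1)).
  by apply: sumr_ge0 => i _; rewrite mulr_ge0 ?addr_ge0// ltW// (Hk i).1.
exists r => // v w vp wp.
pose g (t : R) := v + t *: (w - v).
have := @mean_value_inequality _ _ 0 1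
  (\sum_i k i * (`|'D_(e i) F p| + 1) * `|w - v|) (F \o g) ler01.
rewrite /= /g scale1r scale0r addr0 subr0 mulr1 subrKC mulr_suml; apply=> t t01.
have dg : is_derive t 1 g (w - v).
  pose h : R -> V := *:%R^~ (w - v).
  have -> : g = cst v + h by [].
  have dsc : differentiable h t by [].
  split; first by apply: derivableD => //; exact: diff_derivable.
  rewrite deriveD//; last exact: diff_derivable.
  by rewrite derive_cst add0r deriveE// /h diff_val scale1r.
exists ('d F (g t) (w - v)); first exact: is_derive_diff_comp.
rewrite (diff_frame _ (conj cl lE))//.
rewrite (le_trans (ler_norm_sum _ _ _))//; apply: ler_sum => i _.
rewrite normrZ mulrAC ler_pM//; first exact: (Hk i).2.
apply: Hr; rewrite -ball_normE/= distrC /g.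
have -> : v + t *: (w - v) - p = (1 - t) *: (v - p) + t *: (w - p).
  rewrite scalerBl scale1r addrAC -[RHS]addrA; congr (_ + _).
  by rewrite addrC -scalerBr opprB subrKA.
move: t01 => /andP[t0 t1]; rewrite (le_lt_trans (ler_normD _ _))//.
rewrite !normrZ (ger0_norm t0) (ger0_norm (_ : 0 <= 1 - t)) ?subr_ge0//.
pose m := Num.max `|v - p| `|w - p|.
apply: (@le_lt_trans _ _ ((1 - t) * m + t * m)); last first.
  by rewrite -mulrDl subrK mul1r gt_max vp.
by rewrite lerD// ler_wpM2l ?subr_ge0// le_max lexx ?orbT.
Qed.

Section SmoothMaps.
Context {R : realType}.

Lemma of_class_C_id (V : normedModType R) n : of_class_C n (id : V -> V).
Proof.
case: n => [|n]; first by move=> x; exact: cvg_id.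
split=> [x|v]; first by [].
rewrite (_ : 'D_v id = fun=> v); first exact: of_class_C_cst.
by apply/funext => x; rewrite derive_id.
Qed.

Lemma of_class_C_pair (V W X : normedModType R) n (F : V -> W) (G : V -> X) :
  of_class_C n F -> of_class_C n G -> of_class_C n (fun x => (F x, G x)).
Proof.
elim: n F G => [|n IHn] F G.
  by move=> cF cG x; apply: cvg_pair; [exact: cF|exact: cG].
move=> [dF CF] [dG CG]; split=> [x|v]; first exact: differentiable_pair.
rewrite (_ : 'D_v _ = fun x => ('D_v F x, 'D_v G x)).
  by apply: IHn; [exact: CF|exact: CG].
apply/funext => x; rewrite deriveE; last exact: differentiable_pair.
by rewrite diff_pair// !deriveE.
Qed.

Lemma of_class_C_col_mx (V : normedModType R) k m1 m2 n (F : V -> 'M[R]_(m1, n))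
    (G : V -> 'M[R]_(m2, n)) : of_class_C k F -> of_class_C k G ->
  of_class_C k (fun x => col_mx (F x) (G x)).
Proof.
move=> CF CG; apply: of_class_C_mx => i j.
case: (split_ordP i) => i' ->.
- under eq_fun do rewrite col_mxEu; exact: of_class_C_entry.
- under eq_fun do rewrite col_mxEd; exact: of_class_C_entry.
Qed.

Lemma of_class_C_usubmx k m1 m2 n : of_class_C k (usubmx : 'M[R]_(m1 + m2, n) -> _).
Proof.
apply: of_class_C_mx => i j; under eq_fun do rewrite mxE.
by apply: of_class_C_entry; exact: of_class_C_id.
Qed.

Lemma of_class_C_dsubmx k m1 m2 n : of_class_C k (dsubmx : 'M[R]_(m1 + m2, n) -> _).
Proof.
apply: of_class_C_mx => i j; under eq_fun do rewrite mxE.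
by apply: of_class_C_entry; exact: of_class_C_id.
Qed.

Lemma of_class_CB (V W : normedModType R) n (F G : V -> W) : framed W ->
  of_class_C n F -> of_class_C n G -> of_class_C n (fun x => F x - G x).
Proof.
move=> fW CF CG; apply: of_class_CD => //.
under eq_fun do rewrite -scaleN1r.
by apply: of_class_CZ => //; exact: of_class_C_cst.
Qed.

Lemma of_class_C_lie n k (X Y : 'cV[R]_n -> 'cV[R]_n) :
  of_class_C k.+1 X -> of_class_C k.+1 Y -> of_class_C k (lie X Y).
Proof.
have fW := @framed_mx R n 1; move=> CX CY.
by apply: of_class_CB => //; apply: of_class_C_diff => //;
  by [exact: of_class_C_id | exact: of_class_C_pred].
Qed.

Lemma of_class_C_jac k n p (F : 'cV[R]_n -> 'cV[R]_p) :
  smooth F -> of_class_C k (jac F).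
Proof.
move=> sF; apply: of_class_C_mx => i j; under eq_fun do rewrite mxE.
by apply: of_class_C_entry; have [_ + ] := sF k.+1; exact.
Qed.

End SmoothMaps.

(** * The vector fields of a controlled mechanical system *)

Section SmoothVectorFields.
Context {R : realType} {r m : nat} (S : mech_system R r m) (C : coord_change R r).
Let state := 'cV[R]_(r + r).

Lemma Mmat_unit q : Mmat S q \in unitmx.
Proof.
rewrite unitmxE unitfE; apply/det0P => -[v v0 vM].
have := @Mmat_posdef _ _ _ S q v^T; rewrite -(inj_eq trmx_inj) trmxK trmx0 => /(_ v0).
by rewrite vM mul0mx mxE ltxx.
Qed.

Lemma of_class_C_psi_inv k : of_class_C k (fun x : state => psi_inv C (usubmx x)).
Proof.
apply: (of_class_C_comp (framed_mx _ _) (framed_mx _ _)).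
  exact: of_class_C_usubmx.
exact: psi_inv_smooth.
Qed.

Lemma of_class_C_at_psi_inv k (X : normedModType R) (F : 'cV[R]_r -> X) : framed X ->
  of_class_C k F -> of_class_C k (fun x : state => F (psi_inv C (usubmx x))).
Proof.
move=> fX; apply: (of_class_C_comp (framed_mx _ _) fX); exact: of_class_C_psi_inv.
Qed.



Lemma of_class_C_Pinv k :
  of_class_C k (fun x : state => invmx (Pmat C (psi_inv C (usubmx x)))).
Proof.
apply: of_class_C_invmx; first by move=> x; exact: Pmat_unit.
by apply: of_class_C_at_psi_inv (framed_mx _ _) _; exact: Pmat_smooth.
Qed.

Lemma of_class_C_Minv k :
  of_class_C k (fun x : state => invmx (Mmat S (psi_inv C (usubmx x)))).
Proof.
apply: of_class_C_invmx; first by move=> x; exact: Mmat_unit.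
by apply: of_class_C_at_psi_inv (framed_mx _ _) _; exact: Mmat_smooth.
Qed.

Lemma of_class_C_fvec k : of_class_C k (fvec S C).
Proof.
have CP l : of_class_C l (fun x : state => Pmat C (psi_inv C (usubmx x))).
  by apply: of_class_C_at_psi_inv (framed_mx _ _) _; exact: Pmat_smooth.
have Cv l : of_class_C l
    (fun x : state => invmx (Pmat C (psi_inv C (usubmx x))) *m dsubmx x).
  by apply: of_class_C_mulmx; [exact: of_class_C_Pinv|exact: of_class_C_dsubmx].
apply: of_class_C_col_mx.
  apply: of_class_C_mulmx; last exact: of_class_C_dsubmx.
  apply: of_class_C_mulmx; last exact: of_class_C_Pinv.
  apply: of_class_C_at_psi_inv (framed_mx _ _) _; apply: of_class_C_jac.
  exact: psi_smooth.
apply: of_class_CB; first exact: framed_mx.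
  rewrite /=; under eq_fun do rewrite -mulmxA.
  apply: of_class_C_mulmx => //.
  under eq_fun do (rewrite deriveE; last by have [] := Pmat_smooth C 1).
  apply: of_class_C_diff => //; try exact: framed_mx.
    exact: Pmat_smooth.
  exact: of_class_C_psi_inv.
apply: of_class_C_mulmx.
  by apply: of_class_C_mulmx => //; exact: of_class_C_Minv.
apply: (of_class_C_comp (G := Nvec S)); try exact: framed_mx.
- by apply: framed_prod; exact: framed_mx.
- by apply: of_class_C_pair => //; exact: of_class_C_psi_inv.
- exact: Nvec_smooth.
Qed.

Lemma of_class_C_gvec k i : of_class_C k (gvec S C i).
Proof.
apply: of_class_C_col_mx; first exact: of_class_C_cst.
apply: of_class_C_mx => a b; under eq_fun do rewrite mxE.
apply: of_class_C_entry; apply: of_class_C_mulmx.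
  apply: of_class_C_mulmx; last exact: of_class_C_Minv.
  by apply: of_class_C_at_psi_inv (framed_mx _ _) _; exact: Pmat_smooth.
by apply: of_class_C_at_psi_inv (framed_mx _ _) _; exact: Qmat_smooth.
Qed.

End SmoothVectorFields.

Lemma derive_affine {R : realType} {V W : normedModType R} (F : V -> W) (x v : V)
    (w : W) : (forall h : R, F (h *: v + x) = F x + h *: w) -> 'D_v F x = w.
Proof.
move=> FE; apply: cvg_lim => //; apply: cvg_near_cst.
near=> h; rewrite /= FE addrAC subrr add0r scalerA mulVf ?scale1r//.
by near: h; exact: nbhs_dnbhs_neq.
Unshelve. all: by end_near. Qed.

Lemma diff_entry {R : realType} {V : normedModType R} {m n : nat}
    (F : V -> 'M[R]_(m, n)) (x v : V) i j : differentiable F x ->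
  ('d F x v) i j = 'D_v (fun y => F y i j) x.
Proof.
move=> dF; have dl A : differentiable (mx_coord (i, j) : 'M[R]_(m, n) -> R) A.
  by apply: linear_differentiable; exact: mx_coord_continuous.
rewrite [RHS]deriveE; last exact: (differentiable_comp dF (dl _)).
rewrite (diff_comp dF (dl _))/= diff_lin//; exact: mx_coord_continuous.
Qed.

Lemma diff_jac {R : realType} {n p : nat} (F : 'cV[R]_n -> 'cV[R]_p) x v :
  differentiable F x -> 'd F x v = jac F x *m v.
Proof.
move=> dF; rewrite {1}(matrix_sum_delta v) linear_sum; apply/matrixP => a b.
rewrite summxE mxE; apply: eq_bigr => j _.
by rewrite big_ord1 linearZ mxE !mxE deriveE// (ord1 b) mulrC.
Qed.

Lemma dotv_unitmx_eq0 {R : realType} {n : nat} (A : 'M[R]_n) (v : 'cV[R]_n) :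
  A \in unitmx -> (forall i, dotv v (col i A) = 0) -> v = 0.
Proof.
move=> uA vA; apply: trmx_inj; rewrite trmx0 -[LHS](mulmxK uA).
suff -> : v^T *m A = 0 by rewrite mul0mx.
apply/rowP => i; rewrite [RHS]mxE -(vA i) /dotv !mxE.
by apply: eq_bigr => j _; rewrite !mxE.
Qed.

Lemma dotv_col_mx {R : realType} {m n : nat} (l : 'cV[R]_(m + n)) (a : 'cV_m)
    (b : 'cV_n) : dotv l (col_mx a b) = dotv (usubmx l) a + dotv (dsubmx l) b.
Proof. by rewrite /dotv -{1}[l]vsubmxK tr_col_mx mul_row_col mxE. Qed.

Lemma lieE {R : realType} {n : nat} (X Y : 'cV[R]_n -> 'cV[R]_n) x v w :
  'd Y x (X x) = v -> 'd X x (Y x) = w -> lie X Y x = v - w.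
Proof. by move=> <- <-. Qed.

Section Brackets.
Context {R : realType} {r m : nat} (S : mech_system R r m) (C : coord_change R r).
Local Notation state := 'cV[R]_(r + r).

Lemma fvec_differentiable x : differentiable (fvec S C) x.
Proof. by have [] := of_class_C_fvec S C 1. Qed.

Lemma gvec_differentiable i x : differentiable (gvec S C i) x.
Proof. by have [] := of_class_C_gvec S C 1 i. Qed.

(** The control fields depend on the configuration x1 only, hence are constant in
the vertical directions (0, v). *)
Lemma diff_gvec_vertical i (x v : state) : usubmx v = 0 -> 'd (gvec S C i) x v = 0.
Proof.
move=> v0; rewrite -deriveE; last exact: gvec_differentiable.
by apply: derive_affine => h; rewrite scaler0 addr0 /gvec linearP/= v0 scaler0 add0r.
Qed.

Lemma usubmx_gvec i (x : state) : usubmx (gvec S C i x) = 0.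
Proof. by rewrite /gvec col_mxKu. Qed.

Lemma lie_gvec_gvec i j (x : state) : lie (gvec S C j) (gvec S C i) x = 0.
Proof.
have dg a b : 'd (gvec S C a) x (gvec S C b x) = 0.
  by apply: diff_gvec_vertical; exact: usubmx_gvec.
by rewrite (lieE (dg i j) (dg j i)) subrr.
Qed.

Lemma usubmx_diff_gvec i (x v : state) : usubmx ('d (gvec S C i) x v) = 0.
Proof.
apply/matrixP => a b; rewrite !mxE diff_entry; last exact: gvec_differentiable.
rewrite (_ : (fun _ => _) = cst 0) ?derive_cst//.
by apply/funext => y; rewrite /gvec col_mxEu mxE.
Qed.

(** The configuration component F(x1) x2 of the drift is affine along the vertical
line through x in the direction g_i. *)
Lemma usubmx_lie_fvec_gvec i (x : state) :
  usubmx (lie (fvec S C) (gvec S C i) x) =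
  - (Fmat C (usubmx x) *m col i (Ghat S C (usubmx x))).
Proof.
rewrite (lieE erefl erefl) linearB.
apply: etrans (congr1 (+%R^~ _) (usubmx_diff_gvec _ _ _)) _.
rewrite sub0r; congr (- _).
apply/matrixP => a b; rewrite mxE diff_entry; last exact: fvec_differentiable.
apply: derive_affine => h; rewrite /fvec !col_mxEu.
rewrite !linearP/= usubmx_gvec scaler0 add0r {1}/gvec col_mxKd addrC.
by rewrite mxE [X in _ + X]mxE.
Qed.

(** The configuration component of [f, g_i] depends on x1 only, so that it does
not vary in the vertical direction g_j. *)
Lemma usubmx_lie_gvec_lie i j (x : state) :
  usubmx (lie (gvec S C j) (lie (fvec S C) (gvec S C i)) x) = 0.
Proof.
rewrite (lieE erefl erefl) linearB.
apply: etrans (congr1 (fun z => _ - z) (usubmx_diff_gvec _ _ _)) _.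
rewrite subr0.
apply/matrixP => a b; rewrite mxE [RHS]mxE diff_entry; last first.
  by have [] := of_class_C_lie (of_class_C_fvec S C 2) (of_class_C_gvec S C 2 i).
have E y : lie (fvec S C) (gvec S C i) y (lshift r a) b =
    (- (Fmat C (usubmx y) *m col i (Ghat S C (usubmx y)))) a b.
  by rewrite -usubmx_lie_fvec_gvec [RHS]mxE.
apply: derive_affine => h; rewrite scaler0 addr0 !E.
by rewrite linearP/= usubmx_gvec scaler0 add0r.
Qed.

End Brackets.

Section FullyActuatedBrackets.
Context {R : realType} {r : nat} (S : mech_system R r r) (C : coord_change R r).
Local Notation state := 'cV[R]_(r + r).

Lemma Fmat_unit x1 : Fmat C x1 \in unitmx.
Proof.
rewrite unitmx_mul unitmx_inv Pmat_unit andbT; set q := psi_inv C x1.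
have dpsi : differentiable (psi C) q by have [] := psi_smooth C 1.
have dinv : differentiable (psi_inv C) (psi C q) by have [] := psi_inv_smooth C 1.
apply: (proj2 (@mulmx1_unit _ _ (jac (psi_inv C) (psi C q)) _ _)).
apply/matrixP => a b.
have : 'd (psi_inv C \o psi C) q (delta_mx b 0) = delta_mx b 0.
  rewrite (_ : _ \o _ = id) ?diff_val//.
  by apply/funext => y; exact: psiK.
rewrite (diff_comp dpsi dinv)/= !diff_jac// mulmxA -colE => /matrixP/(_ a 0).
by rewrite !mxE eqxx andbT.
Qed.

Lemma Ghat_unit x1 : Ghat S C x1 \in unitmx.
Proof.
rewrite !unitmx_mul Pmat_unit unitmx_inv Mmat_unit/= -row_full_unit.
by rewrite /row_full Qmat_rank.
Qed.

(** With as many controls as degrees of freedom the g_i span the vertical space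
{0} x R^r and the configuration components - F g_i of the [f, g_i] span R^r: the
2r vectors form a basis, and no nonzero covector annihilates it. *)
Lemma gvec_lie_annihilator (l x : state) :
  (forall i, dotv l (gvec S C i x) = 0) ->
  (forall i, dotv l (lie (fvec S C) (gvec S C i) x) = 0) -> l = 0.
Proof.
move=> lg llie.
have ld : dsubmx l = 0.
  apply: (dotv_unitmx_eq0 (Ghat_unit (usubmx x))) => i.
  by have := lg i; rewrite dotv_col_mx {1}/dotv mulmx0 mxE add0r.
have lu : usubmx l = 0.
  have uFG : Fmat C (usubmx x) *m Ghat S C (usubmx x) \in unitmx.
    by rewrite unitmx_mul Fmat_unit Ghat_unit.
  apply: (dotv_unitmx_eq0 uFG) => i.
  have := llie i; rewrite -[X in dotv l X]vsubmxK dotv_col_mx ld.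
  rewrite usubmx_lie_fvec_gvec [dotv 0 _]/dotv trmx0 mul0mx [X in _ + X]mxE addr0.
  rewrite /dotv mulmxN mxE => /eqP; rewrite oppr_eq0 => /eqP.
  by rewrite !colE mulmxA.
by rewrite -[l]vsubmxK ld lu col_mx0.
Qed.

Lemma vertical_in_span (x w : state) : usubmx w = 0 ->
  exists a : 'cV[R]_r, w = \sum_l a l 0 *: gvec S C l x.
Proof.
move=> w0; pose G := Ghat S C (usubmx x).
exists (invmx G *m dsubmx w); rewrite -[LHS]vsubmxK w0.
have wE : dsubmx w = \sum_l (invmx G *m dsubmx w) l 0 *: col l G.
  rewrite -[LHS](mulKVmx (Ghat_unit (usubmx x))) -/G.
  set c := invmx G *m _; apply/matrixP => a b; rewrite summxE mxE.
  by apply: eq_bigr => j _; rewrite !mxE mulrC (ord1 b).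
rewrite [X in col_mx _ X]wE; apply/matrixP => a b; rewrite summxE.
case: (split_ordP a) => a' ->.
- have gE j : gvec S C j x (lshift r a') b = 0 by rewrite /gvec col_mxEu mxE.
  rewrite col_mxEu mxE big1// => j _; rewrite mxE; apply: etrans (mulr0 _).
  by congr (_ * _); exact: gE.
- rewrite col_mxEd summxE; apply: eq_bigr => j _.
  have gE : gvec S C j x (rshift r a') b = col j G a' b by rewrite /gvec col_mxEd.
  rewrite [LHS]mxE [RHS]mxE; congr (_ * _); exact/esym/gE.
Qed.

(** The equation by which the structure coefficients are chosen has a solution
because the bracket is vertical. *)
Lemma struct_coefP i j (x : state) :
  lie (gvec S C j) (lie (fvec S C) (gvec S C i)) x =
  \sum_k struct_coef S C i j k x *: gvec S C k x.
Proof.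
have [a aE] := vertical_in_span x (usubmx_lie_gvec_lie S C i j x).
exact: (@getPex _ [set a : 'cV[R]_r |
     lie (gvec S C j) (lie (fvec S C) (gvec S C i)) x = \sum_l a l 0 *: gvec S C l x]
  (ex_intro _ a aE)).
Qed.

End FullyActuatedBrackets.

(** * Derivatives along an extremal *)

Section Dot.
Context {R : realType} {n : nat}.
Implicit Types l v : 'cV[R]_n.

Lemma dotvE l v : dotv l v = \sum_i l i 0 * v i 0.
Proof. by rewrite /dotv mxE; apply: eq_bigr => i _; rewrite mxE. Qed.

Definition dot_linear l : {linear 'cV[R]_n -> R} :=
  mx_coord (0, 0) \o mulmx l^T.

Lemma dot_linearE l v : dot_linear l v = dotv l v.
Proof. by []. Qed.

Lemma dot_linear_continuous l : continuous (dot_linear l).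
Proof.
apply: (@of_class_C_continuous _ _ _ 0 _); apply: of_class_C_entry.
by apply: of_class_C_mulmx; [exact: of_class_C_cst|exact: of_class_C_id].
Qed.

Lemma dotv_sumZ (I : finType) l (a : I -> R) (v : I -> 'cV[R]_n) :
  dotv l (\sum_i a i *: v i) = \sum_i a i * dotv l (v i).
Proof.
by rewrite -dot_linearE linear_sum; apply: eq_bigr => i _; rewrite linearZ.
Qed.

Lemma derive_dotv {V : normedModType R} l (F : V -> 'cV[R]_n) (x v : V) :
  differentiable F x -> 'D_v (fun y => dotv l (F y)) x = dotv l ('d F x v).
Proof.
move=> dF; have dl w : differentiable (dot_linear l) w.
  by apply: linear_differentiable; exact: dot_linear_continuous.
rewrite deriveE; last exact: (differentiable_comp dF (dl _)).
by rewrite (diff_comp dF (dl _))/= diff_lin//; exact: dot_linear_continuous.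
Qed.

(** The local Lipschitz bound on this function of the pair (lam, x) makes
lam . Y(x) absolutely continuous near each time. *)
Lemma of_class_C_dotv (k : nat) (Y : 'cV[R]_n -> 'cV[R]_n) : of_class_C k Y ->
  of_class_C k (fun p : 'cV[R]_n * 'cV[R]_n => dotv p.1 (Y p.2)).
Proof.
move=> CY; under eq_fun do rewrite dotvE.
have C1 : of_class_C k (fst : 'cV[R]_n * 'cV[R]_n -> 'cV[R]_n).
  by apply: (of_class_C_linear (L := fst)) (@of_class_C_id _ _ _) => x; exact: cvg_fst.
have C2 : of_class_C k (snd : 'cV[R]_n * 'cV[R]_n -> 'cV[R]_n).
  by apply: (of_class_C_linear (L := snd)) (@of_class_C_id _ _ _) => x; exact: cvg_snd.
apply: of_class_C_sum => i; apply: of_class_CM; apply: of_class_C_entry => //.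
by apply: of_class_C_comp => //; exact: framed_mx.
Qed.

Lemma is_derive_dotv (F G : R -> 'cV[R]_n) (t : R) v w :
  is_derive t 1 F v -> is_derive t 1 G w ->
  is_derive t 1 (fun s => dotv (F s) (G s)) (dotv v (G t) + dotv (F t) w).
Proof.
have entry (H : R -> 'cV[R]_n) z i : is_derive t 1 H z ->
    is_derive t 1 (fun s => H s i 0) (z i 0).
  move=> dH; have dl : differentiable (mx_coord (i, 0) : 'cV[R]_n -> R) (H t).
    by apply: linear_differentiable; exact: mx_coord_continuous.
  have := is_derive_diff_comp dl dH; rewrite diff_lin//; exact: mx_coord_continuous.
move=> dF dG.
rewrite (_ : (fun _ => _) = \sum_i (fun s => F s i 0) * (fun s => G s i 0)); last first.
  by apply/funext => s; rewrite dotvE fct_sumE.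
rewrite !dotvE -big_split/=.
rewrite (eq_bigr (fun i => F t i 0 *: w i 0 + G t i 0 *: v i 0)); last first.
  by move=> i _; rewrite addrC [v i 0 * _]mulrC.
apply: is_derive_sum => i; exact: is_deriveM (entry _ _ _ dF) (entry _ _ _ dG).
Qed.

End Dot.

Definition controlled_field {R : realType} {n m : nat} (f : 'cV[R]_n -> 'cV[R]_n)
    (g : 'I_m -> 'cV[R]_n -> 'cV[R]_n) (u : 'cV[R]_m) (x : 'cV[R]_n) : 'cV[R]_n :=
  f x + \sum_i u i 0 *: g i x.

Section ControlledField.
Context {R : realType} {n m : nat} (f : 'cV[R]_n -> 'cV[R]_n)
  (g : 'I_m -> 'cV[R]_n -> 'cV[R]_n) (u : 'cV[R]_m) (x : 'cV[R]_n).
Hypotheses (df : differentiable f x) (dg : forall i, differentiable (g i) x).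

Let controlled_fieldE : controlled_field f g u = f + \sum_i u i 0 *: g i.
Proof. by apply/funext => y; rewrite /controlled_field fctE fct_sumE. Qed.

Let dgu i : differentiable (u i 0 *: g i) x.
Proof. exact: differentiableZ. Qed.

Lemma differentiable_controlled_field : differentiable (controlled_field f g u) x.
Proof.
by rewrite controlled_fieldE; apply: differentiableD => //; exact: differentiable_sum.
Qed.

Lemma diff_controlled_field (v : 'cV[R]_n) :
  'd (controlled_field f g u) x v = 'd f x v + \sum_i u i 0 *: 'd (g i) x v.
Proof.
apply: etrans (esym (deriveE _ differentiable_controlled_field)) _.
rewrite controlled_fieldE deriveD; last 2 first.
- exact: diff_derivable.
- by apply/diff_derivable/differentiable_sum.
congr (_ + _); first exact: deriveE.
rewrite derive_sum => [|i]; last exact: diff_derivable.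
apply: eq_bigr => i _; rewrite deriveZ; last exact: diff_derivable.
by congr (_ *: _); exact: deriveE.
Qed.

Lemma dotv_lie_controlled_field (l : 'cV[R]_n) (Y : 'cV[R]_n -> 'cV[R]_n) :
  dotv l (lie (controlled_field f g u) Y x) =
  dotv l (lie f Y x) + \sum_i u i 0 * dotv l (lie (g i) Y x).
Proof.
have -> : lie (controlled_field f g u) Y x = lie f Y x + \sum_i u i 0 *: lie (g i) Y x.
  rewrite (lieE erefl (diff_controlled_field _)) {1}/controlled_field.
  have alg (a b : 'cV[R]_n) (p q : 'I_m -> 'cV[R]_n) :
      a + \sum_i u i 0 *: p i - (b + \sum_i u i 0 *: q i) =
      a - b + \sum_i u i 0 *: (p i - q i).
    rewrite opprD addrACA -sumrB; congr (_ + _).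
    by apply: eq_bigr => i _; rewrite scalerBr.
  apply: etrans (alg _ _ _ _); congr (_ - _).
  rewrite linearD linear_sum; congr (_ + _).
  by apply: eq_bigr => i _; rewrite linearZ.
rewrite -dot_linearE linearD linear_sum; congr (_ + _).
by apply: eq_bigr => i _; rewrite linearZ.
Qed.

End ControlledField.

Section Extremal.
Context {R : realType} {r m : nat} (S : mech_system R r m) (C : coord_change R r).
Local Notation state := 'cV[R]_(r + r).
Local Notation f := (fvec S C).
Local Notation g := (gvec S C).

Local Notation F := (controlled_field f g).

Lemma hamiltonianE l x u : hamiltonian S C l x u = dotv l (F u x).
Proof.
rewrite /hamiltonian /controlled_field -!dot_linearE linearD linear_sum; congr (_ + _).
by apply: eq_bigr => i _; rewrite linearZ mulrC.
Qed.



Lemma grad_costate l x u :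
  grad (fun l => hamiltonian S C l x u) l = F u x.
Proof.
apply/matrixP => i j; rewrite mxE (ord1 j); apply: derive_affine => h.
rewrite !hamiltonianE !dotvE.
move: (F u x) => w.
under eq_bigr do rewrite !mxE andbT mulrDl.
rewrite big_split/= addrC; congr (_ + _).
rewrite (bigD1 i)//= eqxx mulr1 big1 ?addr0// => k ki.
by rewrite (negbTE ki) mulr0 mul0r.
Qed.

Lemma dotv_grad_state l x u (w : state) :
  dotv (grad (fun y => hamiltonian S C l y u) x) w = dotv l ('d (F u) x w).
Proof.
have dF : differentiable (F u) x.
  apply: differentiable_controlled_field => [|i]; first exact: fvec_differentiable.
  exact: gvec_differentiable.
have -> : (fun y => hamiltonian S C l y u) = (fun y => dotv l (F u y)).
  by apply/funext => y; rewrite hamiltonianE.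
have expand (L : {linear state -> R}) : L w = \sum_i w i 0 * L (delta_mx i 0).
  rewrite {1}(matrix_sum_delta w) linear_sum; apply: eq_bigr => i _.
  by rewrite big_ord1 linearZ.
apply: etrans (esym (expand (dot_linear l \o 'd (F u) x))).
rewrite dotvE; apply: eq_bigr => i _; rewrite mxE mulrC; congr (_ * _).
exact: derive_dotv.
Qed.

Variables (alpha beta : 'I_m -> R) (T lambda0 : R) (x lam : R -> state)
  (u : R -> 'cV[R]_m).
Hypothesis E : extremal S C alpha beta T lambda0 x lam u.

(** Hamilton's equations say that (lam, x) follows the cotangent lift of the field
X = f + sum_i u_i g_i, along which d/dt lam . Y(x) = lam . [X, Y](x). *)
Lemma extremal_is_derive (Y : state -> state) : (forall y, differentiable Y y) ->
  ae_on `[0, T] (fun t => is_derive t 1 (fun s => dotv (lam s) (Y (x s)))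
    (dotv (lam t) (lie f Y (x t)) +
     \sum_i u t i 0 * dotv (lam t) (lie (g i) Y (x t)))).
Proof.
move=> dY; apply: ae_onS (ae_onI (ext_x_eq E) (ext_lam_eq E)) => // t _.
rewrite grad_costate => -[dx dl].
have dH := is_derive_dotv dl (is_derive_diff_comp (dY (x t)) dx).
apply: (is_derive_eq dH); rewrite -dotv_lie_controlled_field; last 2 first.
- exact: fvec_differentiable.
- by move=> i; exact: gvec_differentiable.
have lE : dotv (- grad (fun y => hamiltonian S C (lam t) y (u t)) (x t)) (Y (x t)) =
    - dotv (lam t) ('d (F (u t)) (x t) (Y (x t))).
  by rewrite -dotv_grad_state /dotv linearN mulNmx mxE.
apply: etrans (congr1 (+%R^~ _) lE) _; rewrite addrC.
by rewrite -[in RHS]dot_linearE (lieE erefl erefl) linearB.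
Qed.

Lemma extremal_dotv_cvg (Y : state -> state) t : continuous Y -> 0 <= t <= T ->
  dotv (lam s) (Y (x s)) @[s --> within `[0, T] (nbhs t)] --> dotv (lam t) (Y (x t)).
Proof.
move=> cY t0T.
have cx := abs_continuous_cvg t0T (ext_x_ac E).
have cl := abs_continuous_cvg t0T (ext_lam_ac E).
have cF := of_class_C_continuous (@of_class_C_dotv R _ 0 Y cY).
exact: (cvg_comp _ _ (cvg_pair cl cx) (cF (lam t, x t))).
Qed.

Lemma extremal_locally_ac (Y : state -> state) (t : R) : of_class_C 1 Y -> 0 <= t <= T ->
  exists2 d : R, 0 < d & forall s1 s2, 0 <= s1 -> s2 <= T -> t - d < s1 -> s2 < t + d ->
    abs_continuous_on s1 s2 (fun s => dotv (lam s) (Y (x s))).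
Proof.
move=> CY t0T.
have fr : framed (state * state)%type by apply: framed_prod; exact: framed_mx.
have [L L0 [d d0 HL]] := locally_lipschitz (lam t, x t) fr (of_class_C_dotv CY).
have := abs_continuous_cvg t0T (ext_x_ac E) => /cvgrPdist_lt/(_ d d0).
have := abs_continuous_cvg t0T (ext_lam_ac E) => /cvgrPdist_lt/(_ d d0).
rewrite !near_withinE => /nbhs_ballP[d1 /= d10 H1] /nbhs_ballP[d2 /= d20 H2].
exists (Num.min d1 d2); first by rewrite lt_min d10.
move=> s1 s2 s10 s2T ts1 ts2.
apply: (@abs_continuous_dominated _ _ _ _ _ _ L lam x).
- exact: abs_continuousS s10 s2T (ext_lam_ac E).
- exact: abs_continuousS s10 s2T (ext_x_ac E).
have near_t s : s1 <= s -> s <= s2 -> `|(lam s, x s) - (lam t, x t)| < d.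
  move=> h1 h2.
  have : `|t - s| < Num.min d1 d2 by rewrite ltr_norml; apply/andP; split; lra.
  rewrite lt_min => /andP[b1 b2].
  have s0T : s \in `[0, T] by rewrite in_itv/=; apply/andP; split; lra.
  rewrite prod_normE/= gt_max; apply/andP; split.
    by rewrite distrC; exact: H1.
  by rewrite distrC; exact: H2.
move=> s s' h1 h2 h3.
have ss2 := le_trans h2 h3; have s1s' := le_trans h1 h2.
have := HL (lam s, x s) (lam s', x s') (near_t s h1 ss2) (near_t s' s1s' h3).
move=> /le_trans; apply.
by rewrite ler_wpM2l// prod_normE/= ge_max lerDl lerDr !normr_ge0.
Qed.

(** When Y commutes with the control fields, the discontinuous controls disappear
from the almost everywhere derivative of lam . Y(x); what remains is continuous in
time, and therefore the derivative at every time. *)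
Lemma extremal_derivative_within (Y : state -> state) t : of_class_C 2 Y ->
  (forall i y, lie (g i) Y y = 0) -> 0 <= t <= T ->
  derivative_within 0 T (fun s => dotv (lam s) (Y (x s))) t
    (dotv (lam t) (lie f Y (x t))).
Proof.
move=> CY gY0 t0T.
apply: (@ae_derivative_within _ _ _ _ _ (fun s => dotv (lam s) (lie f Y (x s)))) => //.
- by apply: extremal_locally_ac => //; exact: of_class_C_pred.
- apply: ae_onS (extremal_is_derive _) => //; last by case: CY.
  move=> s _; rewrite big1 ?addr0// => i _; rewrite gY0 -dot_linearE linear0 mulr0//.
- apply: extremal_dotv_cvg => //; apply: (@of_class_C_continuous _ _ _ 0).
  by apply: of_class_C_lie; [exact: of_class_C_fvec|exact: of_class_C_pred].
Qed.

(** The Hamiltonian is affine in each u_i with slope phi_i: compare u(t) with the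
admissible values that differ from it in the i-th component only. *)
Lemma extremal_bang : (forall i, alpha i <= beta i) ->
  ae_on `[0, T] (fun t => forall i,
    (0 < switching_fun S C x lam i t -> u t i 0 = beta i) /\
    (switching_fun S C x lam i t < 0 -> u t i 0 = alpha i)).
Proof.
move=> ab; have [_ adm] := ext_admissible E.
apply: ae_onS (ae_onI adm (ext_max E)) => // t _ [utU umax] i.
have key c : alpha i <= c <= beta i -> switching_fun S C x lam i t * (u t i 0 - c) >= 0.
  move=> cab; pose v := \col_j (if j == i then c else u t j 0).
  have /umax : control_set alpha beta v.
    by move=> j; rewrite mxE; case: eqP => [->//|_]; exact: utU.
  rewrite /hamiltonian lerD2l (bigD1 i)//= [leRHS](bigD1 i)//= mxE eqxx.
  rewrite (eq_bigr (fun j => dotv (lam t) (g j (x t)) * u t j 0)).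
    by rewrite lerD2r mulrBr subr_ge0.
  by move=> j ji; rewrite mxE (negbTE ji).
have /andP[ui iu] := utU i.
split=> ph.
- have := key (beta i); rewrite lexx ab pmulr_rge0// subr_ge0 => /(_ isT) bu.
  by apply/le_anti; rewrite iu bu.
- have := key (alpha i); rewrite lexx ab nmulr_rge0// subr_le0 => /(_ isT) bu.
  by apply/le_anti; rewrite ui bu.
Qed.

End Extremal.

(** * Zeros, limits and spans *)

Lemma derivative_within_zero_near {R : realType} (a b t c : R) (h : R -> R) :
  derivative_within a b h t c -> h t = 0 -> c != 0 ->
  exists2 d : R, 0 < d & forall s, a <= s <= b -> `|t - s| < d -> s != t -> h s != 0.
Proof.
move=> dh ht c0; have c2 : 0 < `|c| / 2 by rewrite divr_gt0// normr_gt0.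
have := dh _ c2; rewrite near_withinE => /nbhs_ballP[d /= d0 Hd].
exists d => // s sab std st; apply/eqP => hs.
have := Hd s std sab; rewrite hs ht subrr sub0r normrN normrM.
have : 0 < `|s - t| by rewrite normr_gt0 subr_eq0.
have : 0 < `|c| by rewrite normr_gt0.
by move: (`|c|) (`|s - t|) => C D; nra.
Qed.

Lemma derivative_within_eq0 {R : realType} (a b s1 s2 t c : R) (h : R -> R) :
  a <= s1 -> s1 < s2 -> s2 <= b -> s1 <= t <= s2 ->
  (forall s, s1 <= s <= s2 -> h s = 0) -> derivative_within a b h t c -> c = 0.
Proof.
move=> as1 s12 s2b /andP[s1t ts2] h0 dh; apply/eqP; apply: contraT => c0.
have ht : h t = 0 by apply: h0; rewrite s1t.
have [d d0 Hd] := derivative_within_zero_near dh ht c0.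
(* One of t + r and t - r lies in [s1, s2], within the radius d of t. *)
pose r := Num.min (d / 2) ((s2 - s1) / 2).
have r0 : 0 < r by rewrite lt_min; apply/andP; split; lra.
have rd : r < d by rewrite gt_min; apply/orP; left; lra.
have rs : r <= (s2 - s1) / 2 by rewrite ge_min lexx orbT.
clearbody r.
have [s [sab s12s std]] : exists s, [/\ s1 <= s <= s2, `|t - s| < d & s != t].
  have [ts|ts] := leP (t + r) s2.
  - exists (t + r); split; first by apply/andP; split; lra.
      by rewrite opprD addNKr normrN gtr0_norm.
    by apply/eqP => E; lra.
  - exists (t - r); split; first by apply/andP; split; lra.
      by rewrite opprB addrC subrK gtr0_norm.
    by apply/eqP => E; lra.
have := Hd s _ s12s std; rewrite h0// eqxx; apply.
by move: sab => /andP[? ?]; apply/andP; split; lra.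
Qed.

Lemma is_derive_derivative_within {R : realType} (a b t c : R) (h : R -> R) :
  is_derive t 1 h c -> derivative_within a b h t c.
Proof.
move=> dh e e0; have [r r0 H] := is_derive_growth dh e0.
rewrite near_withinE; apply/nbhs_ballP; exists r => //= s ts _.
by apply: H; rewrite distrC.
Qed.

Lemma ae_on_exists {R : realType} (s1 s2 : R) (A : R -> Prop) : s1 < s2 ->
  ae_on `[s1, s2] A -> exists2 t, s1 <= t <= s2 & A t.
Proof.
move=> s12 [N [mN N0 subN]]; apply: contrapT => nA.
have sub : `[s1, s2]%classic `<=` N.
  move=> t /= tI; apply: subN => /= H; apply: nA; exists t; last exact: H.
  by move: tI; rewrite in_itv.
have : (lebesgue_measure (`[s1, s2]%classic : set R) <= lebesgue_measure N)%E.
  by apply: le_measure; rewrite ?inE.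
by rewrite [X in (_ <= X)%E]N0 lebesgue_measure_itv/= lte_fin s12 -EFinD lee_fin; lra.
Qed.

Lemma ae_on_notin_finite {R : realType} (D Z : set R) :
  finite_set Z -> ae_on D (fun t => ~ Z t).
Proof.
move=> /finite_set_countable cZ; exists Z; split.
- by apply: countable_measurable.
- exact: countable_lebesgue_measure0.
- by move=> t /= H; apply: contrapT => Zt; apply: H.
Qed.

(** The relation w = - sum_i u_i h_i holds almost everywhere only, and the u_i have
no limit at t0; but they are bounded while the h_i tend to 0, hence w gets
arbitrarily small at times arbitrarily close to t0. *)
Lemma bounded_control_limit {R : realType} {m : nat} (a b t0 : R) (w : R -> R)
    (h u : 'I_m -> R -> R) (B : 'I_m -> R) :
  a < b -> a <= t0 <= b ->
  w t @[t --> within `[a, b] (nbhs t0)] --> w t0 ->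
  (forall i, h i t @[t --> within `[a, b] (nbhs t0)] --> 0) ->
  ae_on `[a, b] (fun t => (forall i, `|u i t| <= B i) /\
     w t + \sum_i u i t * h i t = 0) ->
  w t0 = 0.
Proof.
move=> ab /andP[at0 t0b] cw ch aeE; apply/eqP; apply: contraT => w0.
have e0 : 0 < `|w t0| / 2 by rewrite divr_gt0// normr_gt0.
have cH : \sum_i `|B i| * `|h i t| @[t --> within `[a, b] (nbhs t0)] --> (0 : R).
  rewrite [X in _ --> X](_ : 0 = \sum_(i < m) `|B i| * `|0 : R|); last first.
    by rewrite big1// => i _; rewrite normr0 mulr0.
  pose FB i t := `|B i| * `|h i t|.
  apply: (@cvg_big R 'I_m +%R 0 xpredT (@add_continuous _) _ _ _ FB) => i _.
  by apply: cvgMl_tmp; apply: cvg_norm; exact: ch.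
move/cvgrPdist_lt : cw => /(_ _ e0); move/cvgrPdist_lt : cH => /(_ _ e0).
rewrite !near_withinE => /nbhs_ballP[d1 /= d10 H1] /nbhs_ballP[d2 /= d20 H2].
pose d := Num.min d1 d2 / 2.
have d0 : 0 < d by rewrite divr_gt0// lt_min d10.
(* On [s1, s2], which has positive length, the two limits are approached up to
half of the norm of w t0, and some t in it satisfies the relation. *)
pose s1 := Num.max a (t0 - d); pose s2 := Num.min b (t0 + d).
have as1 : a <= s1 by rewrite le_max lexx.
have s2b : s2 <= b by rewrite ge_min lexx.
have ts1 : t0 - d <= s1 by rewrite le_max lexx orbT.
have ts2 : s2 <= t0 + d by rewrite ge_min lexx orbT.
have s12 : s1 < s2 by rewrite gt_max !lt_min; apply/andP; split; apply/andP; split; lra.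
have sub : `[s1, s2]%classic `<=` `[a, b].
  by move=> s /=; rewrite !in_itv/= => /andP[? ?]; apply/andP; split; lra.
have [t /andP[s1t ts] [uB E]] := ae_on_exists s12 (ae_onS sub (fun _ _ H => H) aeE).
have tab : t \in `[a, b] by apply: sub; rewrite /= in_itv/= s1t.
have : `|t0 - t| < Num.min d1 d2.
  rewrite -[X in _ < X](divfK (_ : 2 != 0)) ?pnatr_eq0// -/d ltr_norml.
  by apply/andP; split; lra.
rewrite lt_min => /andP[b1 b2].
have := H1 t b1 tab; have := H2 t b2 tab; rewrite sub0r normrN.
have -> : w t = - \sum_i u i t * h i t by apply/eqP; rewrite -addr_eq0 E.
set s := \sum_i u i t * h i t => h1 h2.
have : `|s| <= \sum_i `|B i| * `|h i t|.
  rewrite (le_trans (ler_norm_sum _ _ _))//; apply: ler_sum => i _.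
  by rewrite normrM ler_wpM2r// (le_trans (uB i))// ler_norm.
have := ler_norm (\sum_i `|B i| * `|h i t|).
have : `|w t0| <= `|w t0 - - s| + `|s|.
  by rewrite -{1}[w t0](subrK (- s)) (le_trans (ler_normD _ _))// normrN.
move: h1 h2; move: (`|s|) (`|w t0|) (`|w t0 - - s|) => *; lra.
Qed.

Lemma span_annihilator {R : realType} {n : nat} (l : 'cV[R]_n) (X : seq 'cV[R]_n) :
  (<<X>> = fullv)%VS -> (forall v, v \in X -> dotv l v = 0) -> l = 0.
Proof.
move=> Xfull lX; pose phi := linfun (mulmx l^T : {linear 'cV[R]_n -> 'M[R]_1}).
have H : {in <<X>>%VS, phi =1 (0 : 'Hom('cV[R]_n, 'M[R]_1))}.
  apply/span_lfunP => v vX; rewrite lfunE/= zero_lfunE.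
  by apply/matrixP => i j; rewrite !ord1 [RHS]mxE; exact: lX.
apply/colP => i; have := H (delta_mx i 0); rewrite Xfull memvf => /(_ isT).
rewrite lfunE/= zero_lfunE => /matrixP/(_ 0 0).
by rewrite -colE !mxE.
Qed.

Lemma sum_lift {V : nmodType} (n : nat) (k : 'I_n) (F : 'I_n -> V) :
  \sum_(j | j != k) F j = \sum_j F (lift k j).
Proof.
rewrite (reindex_omap (lift k) (unlift k)) => [|j jk].
  by apply: eq_bigl => j; rewrite liftK eqxx andbT eq_sym neq_lift.
by case: unliftP jk => [j' ->//|->]; rewrite eqxx.
Qed.

(** * Extremals of fully actuated systems *)

Section FullyActuatedExtremal.
Context {R : realType} {r : nat} (S : mech_system R r r) (C : coord_change R r).
Variables (alpha beta : 'I_r -> R) (T lambda0 : R) (x lam : R -> 'cV[R]_(r + r))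
  (u : R -> 'cV[R]_r).
Hypothesis hU : forall i, alpha i < 0 /\ 0 < beta i.
Hypothesis hT : 0 < T.
Hypothesis E : extremal S C alpha beta T lambda0 x lam u.
Local Notation f := (fvec S C).
Local Notation g := (gvec S C).
Local Notation phi := (switching_fun S C x lam).
Local Notation psi i t := (dotv (lam t) (lie f (g i) (x t))).

Lemma of_class_C_lie_fvec_gvec k i : of_class_C k (lie f (g i)).
Proof. by apply: of_class_C_lie; [exact: of_class_C_fvec|exact: of_class_C_gvec]. Qed.

Lemma switching_fun_derivative i t : 0 <= t <= T ->
  derivative_within 0 T (phi i) t (psi i t).
Proof.
move=> tT; apply: (extremal_derivative_within E) => //; first exact: of_class_C_gvec.
by move=> j y; exact: lie_gvec_gvec.
Qed.

Lemma switching_fun_cvg i t : 0 <= t <= T ->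
  phi i s @[s --> within `[0, T] (nbhs t)] --> phi i t.
Proof.
move=> tT; apply: (extremal_dotv_cvg E) => //.
exact: of_class_C_continuous (of_class_C_gvec S C 0 i).
Qed.

(** Otherwise lam(t) annihilates the basis of the g_i and [f, g_i]. *)
Lemma costate_annihilator t : 0 <= t <= T -> (forall i, phi i t = 0) ->
  exists i, psi i t != 0.
Proof.
move=> tT phi0; apply: contrapT => nex.
have /negP := ext_lam_neq0 E (t := t) (ltac:(by rewrite /= in_itv)); apply.
apply/eqP; apply: (gvec_lie_annihilator (S := S) (C := C) (x := x t)) => // i.
by apply/eqP; apply: contraT => psi0; case: nex; exists i.
Qed.

(** On an interval where all the phi_i vanish, so do their derivatives psi_i. *)
Lemma no_totally_singular (J : interval R) : nontrivial_subinterval T J ->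
  ~ totally_singular_on S C J x lam.
Proof.
move=> [JT [s1 [s2 [s1J s2J s12]]]] sing.
have inJ s : s1 <= s <= s2 -> s \in J.
  by move=> s1s2; apply: (interval_is_interval s1J s2J).
have /andP[s10 _] : 0 <= s1 <= T by have := JT _ s1J; rewrite /= in_itv.
have /andP[_ s2T] : 0 <= s2 <= T by have := JT _ s2J; rewrite /= in_itv.
have s1T : 0 <= s1 <= T by rewrite s10 (le_trans (ltW s12)).
have s1s : s1 <= s1 <= s2 by rewrite lexx ltW.
have [|i /eqP] := costate_annihilator s1T; first by move=> i; exact/sing/inJ.
apply; apply: (derivative_within_eq0 s10 s12 s2T s1s _ (switching_fun_derivative i s1T)).
by move=> s ss; exact/sing/inJ.
Qed.

Variable k : 'I_r.
Hypothesis sing : forall i, i != k -> singular_on S C `[0, T] x lam i.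

Lemma singular_switching_fun i t : i != k -> 0 <= t <= T -> phi i t = 0.
Proof. by move=> ik tT; apply: (sing ik); rewrite in_itv. Qed.

Lemma singular_lie i t : i != k -> 0 <= t <= T -> psi i t = 0.
Proof.
move=> ik tT.
apply: (derivative_within_eq0 (lexx 0) hT (lexx T) tT _ (switching_fun_derivative i tT)).
by move=> s sT; exact: singular_switching_fun.
Qed.

(** At a zero of phi_k all the phi_i vanish, and so do the psi_i with i <> k, being
derivatives of functions that are identically zero. *)
Lemma switching_zero_simple t : 0 <= t <= T -> phi k t = 0 -> psi k t != 0.
Proof.
move=> tT phik; have [|i] := costate_annihilator tT.
  by move=> i; have [->//|ik] := eqVneq i k; exact: singular_switching_fun.
by have [->//|ik] := eqVneq i k; rewrite singular_lie// eqxx.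
Qed.

Lemma switching_fun_neq0_near t : 0 <= t <= T ->
  exists2 d : R, 0 < d &
    forall s, 0 <= s <= T -> `|t - s| < d -> s != t -> phi k s != 0.
Proof.
move=> tT; have [phik|phik] := eqVneq (phi k t) 0.
  exact: derivative_within_zero_near (switching_fun_derivative k tT) phik
    (switching_zero_simple tT phik).
have : 0 < `|phi k t| by rewrite normr_gt0.
move=> p0; have /cvgrPdist_lt/(_ _ p0) := switching_fun_cvg (i := k) tT.
rewrite near_withinE => /nbhs_ballP[d /= d0 Hd]; exists d => // s sT std _.
apply: contraTneq (Hd s std sT) => ->; by rewrite subr0 ltxx.
Qed.

Definition switching_zeros : set R := [set t | 0 <= t <= T /\ phi k t = 0].

Lemma finite_switching_zeros : finite_set switching_zeros.
Proof.
suff : finite_set (`[0, T]%classic `&` switching_zeros).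
  by apply: sub_finite_set => t Zt; split=> //=; rewrite in_itv/= Zt.1.
apply: (@interval_induction _
  (fun c d => finite_set (`[c, d]%classic `&` switching_zeros)) _ _ (ltW hT)).
  move=> a b c ab bc Fab Fbc.
  apply: sub_finite_set (_ : finite_set ((`[a, b] `&` switching_zeros) `|`
    (`[b, c] `&` switching_zeros))); last by rewrite finite_setU.
  move=> t [/=]; rewrite in_itv/= => /andP[ac tc] Zt.
  have [tb|/ltW bt] := leP t b; [left|right]; split=> //=; rewrite in_itv/=.
    by rewrite ac.
  by rewrite bt.
move=> p pT; have [d d0 Hd] := switching_fun_neq0_near pT.
exists d => // a c a0 ap pc cT pa cp.
apply: sub_finite_set (finite_set1 p) => t [/=]; rewrite in_itv/= => /andP[at_ tc].
move=> [tT phit]; apply/eqP; apply: contraT => tp.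
have := Hd t tT _ tp; rewrite phit eqxx; apply.
by rewrite ltr_norml; apply/andP; split; lra.
Qed.

Lemma alpha_le_beta i : alpha i <= beta i.
Proof. by have [a0 b0] := hU i; lra. Qed.

Lemma constant_of_sign (D : set R) : D `<=` `[0, T] ->
  (forall t, D t -> 0 < phi k t) \/ (forall t, D t -> phi k t < 0) ->
  ae_constant_on D (fun t => u t k 0).
Proof.
move=> DT sgn; have bang := extremal_bang E alpha_le_beta.
case: sgn => [pos|neg]; [exists (beta k)|exists (alpha k)];
    apply: ae_onS DT _ bang => t Dt /(_ k)[h1 h2].
- exact/h1/pos.
- exact/h2/neg.
Qed.

Lemma sign_near t : 0 <= t <= T -> phi k t != 0 -> exists2 d : R, 0 < d &
  forall s, 0 <= s <= T -> `|t - s| < d -> 0 < phi k s * phi k t.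
Proof.
move=> tT phik; have p0 : 0 < `|phi k t| by rewrite normr_gt0.
have /cvgrPdist_lt/(_ _ p0) := switching_fun_cvg (i := k) tT.
rewrite near_withinE => /nbhs_ballP[d /= d0 Hd]; exists d => // s sT /Hd/(_ sT).
move: (phi k t) (phi k s) phik => a b a0; rewrite neq_lt in a0 *.
case/orP: a0 => a0; [rewrite (ltr0_norm a0)|rewrite (gtr0_norm a0)];
  by rewrite ltr_norml => /andP[? ?]; nra.
Qed.

Lemma switching_time_zero t : switching_time T (fun t => u t k 0) t -> switching_zeros t.
Proof.
move=> [/=]; rewrite in_itv/= => tT sw; split=> //; apply/eqP; apply: contraT => phik.
have [d d0 Hd] := sign_near tT phik; exfalso; apply: (sw d d0).
have sub s : (`]t - d, t + d[ `&` `[0, T])%classic s -> 0 < phi k s * phi k t.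
  move=> [/=]; rewrite !in_itv/= => /andP[h1 h2] sT; apply: Hd => //.
  by rewrite ltr_norml; apply/andP; split; lra.
apply: constant_of_sign; first by move=> s [].
move: phik; rewrite neq_lt => /orP[neg|pos]; [right|left] => s /sub.
- by rewrite nmulr_lgt0.
- by rewrite pmulr_lgt0.
Qed.

Lemma singular_regular : regular alpha beta T u k.
Proof.
split; last first.
  by apply: sub_finite_set finite_switching_zeros; exact: switching_time_zero.
have bang := extremal_bang E alpha_le_beta.
have nZ := @ae_on_notin_finite _ `[0, T] _ finite_switching_zeros.
apply: ae_onS (ae_onI bang nZ) => // t /= tT [/(_ k)[pos neg] nZt].
have : phi k t != 0.
  by apply/eqP => phik; apply: nZt; split=> //; move: tT; rewrite in_itv.
by rewrite neq_lt => /orP[/neg|/pos]; [left|right].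
Qed.

Lemma constant_of_nonvanishing : (forall t, 0 <= t <= T -> phi k t != 0) ->
  ae_constant_on `[0, T] (fun t => u t k 0).
Proof.
move=> phik; apply: constant_of_sign => //.
apply: (@interval_induction _ (fun c d => (forall t, `[c, d]%classic t -> 0 < phi k t) \/
  (forall t, `[c, d]%classic t -> phi k t < 0)) _ _ (ltW hT)).
  move=> a b c ab bc sab sbc.
  have bab : `[a, b]%classic b by rewrite /= in_itv/= lexx ab.
  have bbc : `[b, c]%classic b by rewrite /= in_itv/= lexx bc.
  have split_ac t : `[a, c]%classic t -> `[a, b]%classic t \/ `[b, c]%classic t.
    rewrite /= !in_itv/= => /andP[at_ tc]; have [tb|/ltW bt] := leP t b.
      by left; rewrite at_.
    by right; rewrite bt.
  case: sab sbc => [pab|nab] [pbc|nbc].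
  - by left => t /split_ac[/pab|/pbc].
  - by have := lt_trans (pab _ bab) (nbc _ bbc); rewrite ltxx.
  - by have := lt_trans (pbc _ bbc) (nab _ bab); rewrite ltxx.
  - by right => t /split_ac[/nab|/nbc].
move=> p pT; have [d d0 Hd] := sign_near pT (phik p pT).
exists d => // a c a0 ap pc cT pa cp.
have sub s : `[a, c]%classic s -> 0 < phi k s * phi k p.
  rewrite /= in_itv/= => /andP[as_ sc]; apply: Hd; first by apply/andP; split; lra.
  by rewrite ltr_norml; apply/andP; split; lra.
have := phik p pT; rewrite neq_lt => /orP[neg|pos]; [right|left] => s /sub.
- by rewrite nmulr_lgt0.
- by rewrite pmulr_lgt0.
Qed.

(** The vanishing function lam . [f, g_i](x), with i <> k, has an almost everywhere
derivative in which the controls do appear. *)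
Lemma singular_equation i : i != k -> ae_on `[0, T] (fun t =>
  dotv (lam t) (ad f 2 (g i) (x t)) +
  \sum_j u t j 0 * dotv (lam t) (lie (g j) (lie f (g i)) (x t)) = 0).
Proof.
move=> ik; have [dY _] := of_class_C_lie_fvec_gvec 1 i.
apply: ae_onS (extremal_is_derive E dY) => // t /=; rewrite in_itv/= => tT dpsi.
have psi0 s : 0 <= s <= T -> psi i s = 0 by move=> sT; exact: singular_lie.
have := is_derive_derivative_within 0 T dpsi.
exact: (derivative_within_eq0 (lexx 0) hT (lexx T) tT psi0).
Qed.

Lemma control_bounded : ae_on `[0, T] (fun t => forall i,
  `|u t i 0| <= Num.max (- alpha i) (beta i)).
Proof.
apply: ae_onS (ext_admissible E).2 => // t _ utU i.
have /andP[h1 h2] := utU i; rewrite ler_norml le_max h2 orbT andbT.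
by rewrite lerNl le_max lerN2 h1.
Qed.

Lemma control_limit (Y : 'cV[R]_(r + r) -> 'cV[R]_(r + r))
    (Z : 'I_r -> 'cV[R]_(r + r) -> 'cV[R]_(r + r)) t0 :
  0 <= t0 <= T -> continuous Y -> (forall j, continuous (Z j)) ->
  (forall j, dotv (lam t0) (Z j (x t0)) = 0) ->
  ae_on `[0, T] (fun t => dotv (lam t) (Y (x t)) +
     \sum_j u t j 0 * dotv (lam t) (Z j (x t)) = 0) ->
  dotv (lam t0) (Y (x t0)) = 0.
Proof.
move=> t0T cY cZ Z0 eqn.
apply: (@bounded_control_limit _ _ 0 T t0 (fun t => dotv (lam t) (Y (x t)))
  (fun j t => dotv (lam t) (Z j (x t))) (fun j t => u t j 0) _ hT t0T
  (extremal_dotv_cvg E cY t0T) _ (ae_onI control_bounded eqn)).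
by move=> j; have := extremal_dotv_cvg E (cZ j) t0T; rewrite (Z0 j).
Qed.

Lemma switching_zero_annihilates t0 : 0 <= t0 <= T -> phi k t0 = 0 ->
  (forall i, dotv (lam t0) (g i (x t0)) = 0) /\
  (forall j, j != k -> dotv (lam t0) (lie f (g j) (x t0)) = 0).
Proof.
move=> t0T phik; split=> [i|j jk]; last exact: singular_lie.
by have [->//|ik] := eqVneq i k; exact: singular_switching_fun.
Qed.

(** At a zero of phi_k the costate annihilates the g_l, hence also the brackets
[g_j, [f, g_i]] that multiply the controls in [singular_equation]. *)
Lemma switching_zero_ad2 t0 i : 0 <= t0 <= T -> phi k t0 = 0 -> i != k ->
  dotv (lam t0) (ad f 2 (g i) (x t0)) = 0.
Proof.
move=> t0T phik ik; have [lg _] := switching_zero_annihilates t0T phik.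
apply: (control_limit (Y := ad f 2 (g i)) (Z := fun j => lie (g j) (lie f (g i)))
  t0T _ _ _ (singular_equation ik)).
- exact: of_class_C_continuous
    (of_class_C_lie (of_class_C_fvec S C 1) (of_class_C_lie_fvec_gvec 1 i)).
- move=> j; exact: of_class_C_continuous
    (of_class_C_lie (of_class_C_gvec S C 1 j) (of_class_C_lie_fvec_gvec 1 i)).
- move=> j; rewrite [X in dotv _ X](struct_coefP S C i j) dotv_sumZ big1// => l _.
  by rewrite (lg l) mulr0.
Qed.

(** On an abnormal extremal lam . f(x) = - sum_j u_j phi_j almost everywhere. *)
Lemma switching_zero_fvec t0 : 0 <= t0 <= T -> phi k t0 = 0 -> lambda0 = 0 ->
  dotv (lam t0) (f (x t0)) = 0.
Proof.
move=> t0T phik l0; have [lg _] := switching_zero_annihilates t0T phik.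
apply: (control_limit (Y := f) (Z := g) t0T _ _ lg).
- exact: of_class_C_continuous (of_class_C_fvec S C 0).
- by move=> j; exact: of_class_C_continuous (of_class_C_gvec S C 0 j).
apply: ae_onS (ext_const E) => // t _; rewrite l0; apply: etrans.
by congr (_ + _); apply: eq_bigr => j _; rewrite mulrC.
Qed.

Lemma costate_span t (X : seq 'cV[R]_(r + r)) : 0 <= t <= T ->
  (<<X>> = fullv)%VS -> ~ (forall v, v \in X -> dotv (lam t) v = 0).
Proof.
move=> tT Xfull /(span_annihilator Xfull) l0.
by have := ext_lam_neq0 E (t := t); rewrite l0 eqxx /= in_itv/= tT => /(_ isT).
Qed.

Lemma nonvanishing_i : (forall t, t \in `[0, T] -> span_cond_i S C k (x t)) ->
  forall t, 0 <= t <= T -> phi k t != 0.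
Proof.
move=> span_i t tT; apply/eqP => phik.
have [lg llie] := switching_zero_annihilates tT phik.
have tI : t \in `[0, T] by rewrite in_itv.
apply: (costate_span tT (span_i t tI)) => v; rewrite !mem_cat => /or3P[] /mapP[j].
- by move=> _ ->.
- by rewrite mem_filter => /andP[jk _] ->; exact: llie.
- by rewrite mem_filter => /andP[jk _] ->; exact: switching_zero_ad2.
Qed.

Lemma nonvanishing_ii : lambda0 = 0 ->
  (forall t, t \in `[0, T] -> span_cond_ii S C k (x t)) ->
  forall t, 0 <= t <= T -> phi k t != 0.
Proof.
move=> l0 span_ii t tT; apply/eqP => phik.
have [lg llie] := switching_zero_annihilates tT phik.
have tI : t \in `[0, T] by rewrite in_itv.
apply: (costate_span tT (span_ii t tI)) => v; rewrite in_cons mem_cat.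
case/or3P => [/eqP->|/mapP[j _ ->]|/mapP[j]].
- exact: switching_zero_fvec.
- exact: lg.
- by rewrite mem_filter => /andP[jk _] ->; exact: llie.
Qed.

(** In lam . [g_j, [f, g_i]](x) = sum_l alpha_ij^l phi_l only the term with l = k
is nonzero. *)
Lemma singular_control_equation : ae_on `[0, T] (fun t => forall i, i != k ->
  dotv (lam t) (ad f 2 (g i) (x t)) +
  (\sum_j struct_coef S C i j k (x t) * u t j 0) * phi k t = 0).
Proof.
have all_i : ae_on `[0, T] (fun t => forall i, i != k ->
    dotv (lam t) (ad f 2 (g i) (x t)) +
    \sum_j u t j 0 * dotv (lam t) (lie (g j) (lie f (g i)) (x t)) = 0).
  apply: ae_on_forall => i; have [->|ik] := eqVneq i k.
    by apply: ae_onS (ext_max E) => // t _ _; rewrite eqxx.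
  by apply: ae_onS (singular_equation ik).
apply: ae_onS all_i => // t /=; rewrite in_itv/= => tT eqn i ik.
rewrite -[RHS](eqn i ik); congr (_ + _); rewrite mulr_suml; apply: eq_bigr => j _.
rewrite (struct_coefP S C i j) dotv_sumZ (bigD1 k)//= big1 ?addr0 => [|l lk].
  by rewrite mulrAC mulrC mulrA.
by rewrite [X in _ * X](singular_switching_fun lk tT) mulr0.
Qed.

End FullyActuatedExtremal.

Lemma singular_control_systemP {R : realType} {r : nat} (S : mech_system R r r)
    (C : coord_change R r) (k : 'I_r) (x l : 'cV[R]_(r + r)) (w : 'cV[R]_r) :
  dotv l (gvec S C k x) != 0 ->
  (forall i, i != k -> dotv l (ad (fvec S C) 2 (gvec S C i) x) +
    (\sum_j struct_coef S C i j k x * w j 0) * dotv l (gvec S C k x) = 0) ->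
  singular_control_system S C k x l (w k 0) w.
Proof.
move=> phik eqn i ik /=; have := eqn i ik.
rewrite (bigD1 k)//=; set s := \sum_(_ | _) _.
move: (dotv l _) (dotv l _) phik (struct_coef _ _ _ _ _ _) (w k 0) => phik A p0 a uk h.
apply/eqP; rewrite -subr_eq0 opprK; apply/eqP; rewrite -[X in _ + X](mulfK p0).
by rewrite -mulrDl [X in X / _](_ : _ = 0) ?mul0r// -h; ring.
Qed.

Lemma singular_control_system_unique {R : realType} {r : nat} (S : mech_system R r r)
    (C : coord_change R r) (k : 'I_r) (x l : 'cV[R]_(r + r)) (uk : R) (v w : 'cV[R]_r) :
  struct_det S C k x != 0 ->
  singular_control_system S C k x l uk v -> singular_control_system S C k x l uk w ->
  forall j, j != k -> w j 0 = v j 0.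
Proof.
move=> detA sv sw j; rewrite eq_sym => /unlift_some[j' -> _].
pose A := row' k (col' k (\matrix_(i, j) struct_coef S C i j k x)).
have uA : A \in unitmx by rewrite unitmxE unitfE.
suff E0 : A *m row' k (w - v) = 0.
  have : row' k (w - v) = 0 by rewrite -(mulKmx uA (row' k _)) E0 mulmx0.
  by move=> /matrixP/(_ j' 0); rewrite !mxE => /eqP; rewrite subr_eq0 => /eqP.
apply/matrixP => i b; rewrite (ord1 b) !mxE.
have ik : lift k i != k by rewrite eq_sym neq_lift.
have := sv _ ik; rewrite /= (sw _ ik) => /eqP.
rewrite eqr_opp -subr_eq0 !sum_lift -sumrB => /eqP H.
by rewrite -[RHS]H; apply: eq_bigr => a _; rewrite !mxE mulrBr.
Qed.

Theorem proposition3 (R : realType) (r : nat)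
    (S : mech_system R r r) (C : coord_change R r)
    (alpha beta : 'I_r -> R) (hU : forall i, alpha i < 0 /\ 0 < beta i)
    (T : R) (hT : 0 < T) :
  (forall (lambda0 : R) (x lam : R -> 'cV[R]_(r + r)) (u : R -> 'cV[R]_r),
    extremal S C alpha beta T lambda0 x lam u ->
    ~ exists J : interval R,
        nontrivial_subinterval T J /\ totally_singular_on S C J x lam) /\
  (forall (k : 'I_r) (lambda0 : R) (x lam : R -> 'cV[R]_(r + r))
      (u : R -> 'cV[R]_r),
    extremal S C alpha beta T lambda0 x lam u ->
    (forall i, i != k -> singular_on S C `[0, T] x lam i) ->
    [/\ regular alpha beta T u k,
        ((forall t, t \in `[0, T] -> span_cond_i S C k (x t)) \/
         (abnormal lambda0 /\
          forall t, t \in `[0, T] -> span_cond_ii S C k (x t))) ->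
        ae_constant_on `[0, T] (fun t => u t k 0)
      & forall J : interval R, [set` J] `<=` `[0, T] ->
        (forall t, t \in J -> switching_fun S C x lam k t != 0) ->
        ae_on [set` J] (fun t =>
          singular_control_system S C k (x t) (lam t) (u t k 0) (u t) /\
          (struct_det S C k (x t) != 0 ->
           forall w : 'cV[R]_r,
             singular_control_system S C k (x t) (lam t) (u t k 0) w ->
             forall j, j != k -> w j 0 = u t j 0))]).
Proof.
split=> [lambda0 x lam u E [J [JT sing]]|k lambda0 x lam u E sing].
  exact: (no_totally_singular E JT sing).
split; first exact: singular_regular hU hT E k sing.
- move=> span; apply: (constant_of_nonvanishing hU hT E) => t tT.
  case: span => [span_i|[l0 span_ii]].
  + exact: nonvanishing_i hT E _ sing span_i t tT.
  + exact: nonvanishing_ii hT E _ sing l0 span_ii t tT.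
- move=> J JT phik; apply: ae_onS (singular_control_equation hT E sing) => // t tJ eqn.
  have sys := singular_control_systemP (phik t tJ) eqn.
  by split=> // detA w; exact: singular_control_system_unique detA sys.
Qed.
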